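(* Consider the problem $\min_xg(x)-h(x)+r(x)$ with possibly non-smooth non-convex $r$, where $g=\frac1{n_1}\sum_{i=1}^{n_1}g_i$ and $h=\frac1{n_2}\sum_{j=1}^{n_2}h_j$ have a finite-sum form, each $g_i$ is $L$-smooth and $h$ is $L$-smooth. Apply the stagewise algorithm with SVRG as subproblem solver to its DC reformulation with smoothing parameter $\mu$. Let $\tau\in\{1,\dots,K\}$ be the sampled index and $w_\tau=\mathrm{prox}_{\mu r}(x_\tau)$, and let $c>0$ be a constant. (a) If $r$ is Lipschitz continuous (R1), then with $\mu=\epsilon$, $\gamma_k=ck^{1/3}$, $T_k\ge\max(2,200L/\gamma_k)$, $S_k=\lceil\log_2(k)\rceil$, the algorithm returns after $K=O(1/\epsilon^3)$ stages a solution $x_\tau$ satisfying $$\mathbb{E}[\|x_\tau-w_\tau\|]\le O(\epsilon),\qquad\mathbb{E}\big[\mathrm{dist}\big(\nabla h(w_\tau),\nabla g(w_\tau)+\hat\partial r(w_\tau)\big)\big]\le O(\epsilon),$$ and the total gradient complexity is $\widetilde O(n/\epsilon^3)$. (b) If (R2) or (R3) holds, then with $\mu=\epsilon^2$, $\gamma_k=ck^{1/2}$, $T_k\ge\max(2,200L/\gamma_k)$, $S_k=\lceil\log_2(k)\rceil$, the algorithm returns after $K=O(1/\epsilon^4)$ stages a solution $x_\tau$ satisfying $$\mathbb{E}[\|x_\tau-w_\tau\|]\le O(\epsilon),\qquad\mathbb{E}\big[\mathrm{dist}\big(\nabla h(w_\tau),\nabla g(w_\tau)+\hat\partial r(w_\tau)\big)\big]\le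 O(\epsilon),$$ and the total gradient complexity is $\widetilde O(n/\epsilon^4)$.
   Context: Setting: $g,h:\mathbb{R}^d\to\mathbb{R}$ are lower-semicontinuous convex, $L$-smooth means differentiable with $L$-Lipschitz gradient, $n=n_1+n_2$, $f=g-h$; $r$ is a proper lower-semicontinuous (possibly non-smooth and non-convex) function whose proximal mapping $\mathrm{prox}_{\mu r}(x)=\arg\min_y\{\frac1{2\mu}\|y-x\|^2+r(y)\}$ exists. $\mathrm{prox}_{\mu r}(x)$ may be set-valued; when used as a vector it denotes a fixed selection (the same wherever it appears). $\hat\partial r(\bar x)=\{v:\liminf_{x\to\bar x}\frac{r(x)-r(\bar x)-v^\top(x-\bar x)}{\|x-\bar x\|}\ge0\}$ is the Fr\'echet subdifferential; $\mathrm{dist}$ is the distance between sets. DC reformulation: $r_\mu(x)=\min_y\{\frac1{2\mu}\|y-x\|^2+r(y)\}=\frac1{2\mu}\|x\|^2-R_\mu(x)$ with $R_\mu(x)=\max_y\{\frac1\mu y^\top x-\frac1{2\mu}\|y\|^2-r(y)\}$ convex and $\frac1\mu\mathrm{prox}_{\mu r}(x)\subseteq\partial R_\mu(x)$. The algorithm is applied to $F(x)=g(x)+\frac1{2\mu}\|x\|^2-(h(x)+R_\mu(x))=f(x)+r_\mu(x)$. Stagewise algorithm: from $x_1$, for $k=1,\dots,K$ obtain $x_{k+1}$ by running SVRG, initialized at $x_k$, on $$F_k(x)=g(x)+\tfrac1{2\mu}\|x\|^2-\big(\nabla h(x_k)+\tfrac1\mu\mathrm{prox}_{\mu r}(x_k)\big)^\top(x-x_k)+\tfrac{\gamma_k}2\|x-x_k\|^2.$$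 Return $x_\tau$ with $\tau$ sampled by $p(\tau=k)=k^\alpha/\sum_{j=1}^Kj^\alpha$, $\alpha\ge1$ fixed. SVRG at stage $k$ (step size $\eta=0.05/L$): $\bar x^{(0)}=x_k$; for $s=1,\dots,S_k$ set $\bar g_s=\nabla g(\bar x^{(s-1)})-\nabla h(x_k)-\frac1\mu\mathrm{prox}_{\mu r}(x_k)$, $x_0^{(s)}=\bar x^{(s-1)}$; for $t=1,\dots,T_k$ pick $i_t\in\{1,\dots,n_1\}$ uniformly, $v_t=\nabla g_{i_t}(x^{(s)}_{t-1})-\nabla g_{i_t}(\bar x^{(s-1)})+\bar g_s$, $x^{(s)}_t=\arg\min_x\langle v_t,x-x^{(s)}_{t-1}\rangle+\frac1{2\eta}\|x-x^{(s)}_{t-1}\|^2+\frac1{2\mu}\|x\|^2+\frac{\gamma_k}2\|x-x_k\|^2$; $\bar x^{(s)}=\frac1{T_k}\sum_{t=1}^{T_k}x^{(s)}_t$. Output $x_{k+1}=\bar x^{(S_k)}$. The total gradient complexity is $\sum_{k=1}^K(n+T_k)S_k$, with $T_k$ taken of the order of its lower bound. Conditions. (R1): $r$ is Lipschitz continuous. (R2): $r$ is lower bounded and finite-valued over $\mathbb{R}^d$. (R3): $f+r_\mu$ is level bounded for a small $\mu<1$, $r$ is finite-valued on a compact set, and $r$ is lower bounded over $\mathbb{R}^d$. Standing assumption: $F(x_1)-\min_xF(x)\le\Delta$ for some $\Delta>0$ independent of $\epsilon$. ''After $K=O(q(\epsilon))$ stages'' means $K=\lceil Cq(\epsilon)\rceil$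 for a constant $C$ independent of $\epsilon\in(0,1)$; all $O(\cdot)$ constants are independent of $\epsilon$; $\widetilde O$ hides logarithmic factors. *)

(* Defs.v *)
From HB Require Import structures.
From mathcomp Require Import all_boot all_order all_algebra.
From mathcomp Require Import all_classical all_reals all_analysis.

Set Implicit Arguments.
Unset Strict Implicit.
Unset Printing Implicit Defensive.

Import Order.TTheory GRing.Theory Num.Theory.
Import numFieldNormedType.Exports.

Local Open Scope classical_set_scope.
Local Open Scope ring_scope.

Section EuclideanSpace.
Context {R : realType} {d : nat}.
Implicit Types (x y v w : 'rV[R]_d) (f g h : 'rV[R]_d -> R)
  (r F : 'rV[R]_d -> \bar R).

Definition dot x y : R := \sum_i x 0 i * y 0 i.

(* The library norm `|x| on 'rV[R]_d is the sup norm, hence this one. The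
   topology, and so [differentiable], is the same for both. *)
Definition enorm x : R := Num.sqrt (dot x x).

Definition grad f x : 'rV[R]_d := \row_i 'D_(delta_mx 0 i) f x.

Definition smooth (L : R) f : Prop :=
  (forall x, differentiable f x) /\
  (forall x y, enorm (grad f x - grad f y) <= L * enorm (x - y)).

Definition convex_fun f : Prop :=
  convex_function (setT : set (convex_lmodType 'rV[R]_d)) f.

Definition proper_fun r : Prop :=
  (forall x, r x != -oo%E) /\ (exists x, (r x < +oo)%E).

Definition prox_objective (mu : R) r x y : \bar R :=
  (((2 * mu)^-1 * enorm (y - x) ^+ 2)%:E + r y)%E.

Definition prox (mu : R) r x : set 'rV[R]_d :=
  [set y | forall z, (prox_objective mu r x y <= prox_objective mu r x z)%E].

Definition moreau (mu : R) r x : \bar R :=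
  ereal_inf (range (prox_objective mu r x)).

(* F = f + r_mu with f = g - h. *)
Definition smoothed g h r (mu : R) x : \bar R :=
  ((g x - h x)%:E + moreau mu r x)%E.

Definition frechet_subdiff r x : set 'rV[R]_d :=
  [set v | (0 <= limf_einf
     (fun y => (r y - r x - (dot v (y - x))%:E) * ((enorm (y - x))^-1)%:E)
     (x^'))%E].

(* +oo when one of the sets is empty. *)
Definition set_dist (A B : set 'rV[R]_d) : \bar R :=
  ereal_inf [set (enorm (a - b))%:E | a in A & b in B].

Definition stationarity_gap g h r w : \bar R :=
  set_dist [set grad h w] [set grad g w + v | v in frechet_subdiff r w].

Definition lipschitz_fun r : Prop :=
  (forall x, r x \is a fin_num) /\
  exists G : R, forall x y, `|fine (r x) - fine (r y)| <= G * enorm (x - y).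

Definition lower_bounded r : Prop := exists m : R, forall x, (m%:E <= r x)%E.

Definition level_bounded F : Prop :=
  forall a : R, bounded_set [set x | (F x <= a%:E)%E].

Definition cond_R1 r : Prop := lipschitz_fun r.

Definition cond_R2 r : Prop :=
  lower_bounded r /\ forall x, r x \is a fin_num.

Definition cond_R3 g h r : Prop :=
  [/\ exists mu0 : R, 0 < mu0 < 1 /\ level_bounded (smoothed g h r mu0),
      exists2 X : set 'rV[R]_d, compact X /\ X !=set0 &
        forall x, X x -> r x \is a fin_num
    & lower_bounded r].

Definition argmin (phi : 'rV[R]_d -> R) : 'rV[R]_d :=
  xget 0 [set x | forall y, phi x <= phi y].

End EuclideanSpace.

Section StagewiseSVRG.
Context {R : realType} {d n1 : nat}.
Variables (gi : 'I_n1 -> 'rV[R]_d -> R) (g h : 'rV[R]_d -> R).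
(* [p] is the selection of x |-> prox mu r x used by the algorithm. *)
Variables (mu eta : R) (p : 'rV[R]_d -> 'rV[R]_d).

Definition svrg_step (gamma : R) (xk v x : 'rV[R]_d) : 'rV[R]_d :=
  argmin (fun y => dot v (y - x) + (2 * eta)^-1 * enorm (y - x) ^+ 2
    + (2 * mu)^-1 * enorm y ^+ 2 + gamma / 2 * enorm (y - xk) ^+ 2).

(* The t-th inner iterate of one epoch with anchor [xbar]; [idx t] is the
   component drawn at inner iteration t >= 1. *)
Fixpoint svrg_inner (gamma : R) (xk xbar : 'rV[R]_d) (idx : nat -> 'I_n1)
    (t : nat) : 'rV[R]_d :=
  if t is t'.+1 then
    let x := svrg_inner gamma xk xbar idx t' in
    let gbar := grad g xbar - grad h xk - mu^-1 *: p xk in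
    let v := grad (gi (idx t)) x - grad (gi (idx t)) xbar + gbar in
    svrg_step gamma xk v x
  else xbar.

Definition svrg_epoch gamma xk xbar idx (T : nat) : 'rV[R]_d :=
  T%:R^-1 *: \sum_(1 <= t < T.+1) svrg_inner gamma xk xbar idx t.

Fixpoint svrg gamma xk (idx : nat -> nat -> 'I_n1) (T S : nat) : 'rV[R]_d :=
  if S is s.+1 then
    svrg_epoch gamma xk (svrg gamma xk idx T s) (idx S) T
  else xk.

(* Stages are numbered from 1, so that [stagewise x1 .. k] is x_k for k >= 1;
   its value at 0 is a dummy. *)
Fixpoint stagewise (x1 : 'rV[R]_d) (gamma : nat -> R) (T S : nat -> nat)
    (idx : nat -> nat -> nat -> 'I_n1) (k : nat) : 'rV[R]_d :=
  match k with
  | (k'.+1 as m).+1 =>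
      svrg (gamma m) (stagewise x1 gamma T S idx m) (idx m) (T m) (S m)
  | _ => x1
  end.

End StagewiseSVRG.

Section Sampling.
Context {R : realType} {disp : measure_display} {Omega : measurableType disp}.
Variable P : probability Omega R.
Local Open Scope ereal_scope.

(* Mutual independence of the nat-valued random variables X j, j \in D (every
   set of naturals is measurable). *)
Definition mutually_independent (J : choiceType) (D : pred J)
    (X : J -> Omega -> nat) : Prop :=
  forall (s : seq J) (B : J -> set nat), uniq s -> all D s ->
    P (\bigcap_(j in [set` s]) (X j @^-1` B j)) =
    \prod_(j <- s) P (X j @^-1` B j).

(* Positions (k, s, t) of the draws i_t performed in stage k <= K, epoch s. *)
Definition draw_position (K : nat) (T S : nat -> nat)
    (a : nat * nat * nat) : bool :=
  let: (k, s, t) := a in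
  [&& (1 <= k <= K)%N, (1 <= s <= S k)%N & (1 <= t <= T k)%N].

(* The family gathering tau (index None) and all the draws. *)
Definition all_draws n1 (i : nat -> nat -> nat -> Omega -> 'I_n1)
    (tau : Omega -> nat) (a : option (nat * nat * nat)) : Omega -> nat :=
  if a is Some (k, s, t) then fun w => nat_of_ord (i k s t w) else tau.

Definition sampling n1 (alpha : R) (K : nat) (T S : nat -> nat)
    (i : nat -> nat -> nat -> Omega -> 'I_n1) (tau : Omega -> nat) : Prop :=
  let D := fun a => if a is Some b then draw_position K T S b else true in
  [/\ forall a, D a -> measurable_fun setT (all_draws i tau a),
      forall k s t, draw_position K T S (k, s, t) ->
        forall j, P (i k s t @^-1` [set j]) = (n1%:R^-1)%:E,
      forall k, (1 <= k <= K)%N ->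
        P (tau @^-1` [set k]) =
        (k%:R `^ alpha / \sum_(1 <= j < K.+1) j%:R `^ alpha)%R%:E
    & mutually_independent D (all_draws i tau)].

End Sampling.

Section Guarantee.
Context {R : realType} {d : nat}.
Variables (g h : 'rV[R]_d -> R) (r : 'rV[R]_d -> \bar R) (x1 : 'rV[R]_d).
Variables (L c alpha : R).

Definition nceil (x : R) : nat := `|Num.ceil x|%N.

Definition inner_bound (gamma : R) : R := Num.max 2 (200 * L / gamma).

(* The guarantee for smoothing parameter mu(eps), gamma_k = c k^rho,
   K = O(1 / eps^e) stages and complexity \tilde O(n / eps^e). The constants
   depend neither on eps nor on the finite-sum decompositions of g and h, so
   that the factor n1 + n2 of the complexity is meaningful. *)
Definition stagewise_guarantee (mu : R -> R) (rho : R) (e : nat) : Prop :=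
  let gamma := fun k : nat => c * k%:R `^ rho in
  let S := fun k : nat => up_log 2 k in
  forall T : nat -> nat,
  (forall k, (0 < k)%N -> inner_bound (gamma k) <= (T k)%:R) ->
  exists (C C1 C2 C3 : R) (q : nat), 0 < C /\
  forall (n1 n2 : nat) (gi : 'I_n1 -> 'rV[R]_d -> R)
    (hj : 'I_n2 -> 'rV[R]_d -> R),
  (0 < n1)%N -> (0 < n2)%N ->
  (forall x, g x = n1%:R^-1 * \sum_i gi i x) ->
  (forall x, h x = n2%:R^-1 * \sum_j hj j x) ->
  (forall i, smooth L (gi i)) ->
  forall eps : R, 0 < eps < 1 ->
  let K := nceil (C / eps ^+ e) in
  (forall p : 'rV[R]_d -> 'rV[R]_d, (forall x, prox (mu eps) r x (p x)) ->
   forall (disp : measure_display) (Omega : measurableType disp)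
     (P : probability Omega R) (i : nat -> nat -> nat -> Omega -> 'I_n1)
     (tau : Omega -> nat),
   sampling P alpha K T S i tau ->
   let x := fun w => stagewise gi g h (mu eps) (5 / 100 / L) p x1 gamma T S
                       (fun k s t => i k s t w) (tau w) in
   ('E_P[fun w => enorm (x w - p (x w))] <= (C1 * eps)%:E)%E /\
   (\int[P]_w stationarity_gap g h r (p (x w)) <= (C2 * eps)%:E)%E) /\
  ((exists CT : R, forall k, (0 < k)%N ->
      (T k)%:R <= CT * inner_bound (gamma k)) ->
   (\sum_(1 <= k < K.+1) (n1 + n2 + T k) * S k)%N%:R
     <= C3 * ((n1 + n2)%:R / eps ^+ e) * (1 + ln eps^-1) ^+ q).

End Guarantee.

(* Main.v *)
Require Import Defs.
From HB Require Import structures.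
From mathcomp Require Import all_boot all_order all_algebra.
From mathcomp Require Import all_classical all_reals all_analysis.
From mathcomp Require Import measurable_realfun ring lra.

(* The random draws play no role: the estimates below hold for every sequence of
   draws, and only the independence of tau from the draws is used.
   Let u(x) = grad g(x) + (x - p(x)) / mu - grad h(x). Since (x - p(x)) / mu is
   a Frechet subgradient of r at p(x), the stationarity gap at p(x) is at most
   |u(x)| + 2 L |x - p(x)|. When 1 / mu is large compared with L, the k-th
   subproblem has a modulus of strong convexity sigma_k = 1 / mu + gamma_k so
   large that every SVRG iterate, whatever the draws, stays close to the gradient
   step x_k - u(x_k) / sigma_k. As f + r_mu is majorized at x_k by a quadratic
   with gradient u(x_k), it decreases by |u(x_k)|^2 / (5 sigma_k) from the second
   stage on (the first one is void, as S_1 = 0). Summing these decreases, with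
   P(tau = k) = O(1 / K) and sigma_(K+1) / K = O(eps^2), gives
   E |u(x_tau)|^2 = O(eps^2). The distance |x_k - p(x_k)| is at most 2 G mu if r
   is G-Lipschitz; if r is bounded below, it is O(sqrt mu) by comparing f + r_mu
   with f + r_(2 mu). Finally, when mu is bounded away from 0, the number of
   stages is bounded and the iterates stay in a fixed ball. *)

Set Implicit Arguments.
Unset Strict Implicit.
Unset Printing Implicit Defensive.

Import Order.TTheory GRing.Theory Num.Theory.
Import numFieldNormedType.Exports.

Local Open Scope classical_set_scope.
Local Open Scope ring_scope.

(** * Euclidean inner product and norm *)

Section Euclidean.
Context {R : realType} {d : nat}.
Implicit Types (x y z v : 'rV[R]_d) (a b : R).

Lemma dotC x y : dot x y = dot y x.
Proof. by apply: eq_bigr => i _; rewrite mulrC. Qed.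

Lemma dotDl x y z : dot (x + y) z = dot x z + dot y z.
Proof. by rewrite /dot -big_split; apply: eq_bigr => i _; rewrite mxE mulrDl. Qed.

Lemma dotZl a x y : dot (a *: x) y = a * dot x y.
Proof. by rewrite /dot big_distrr /=; apply: eq_bigr => i _; rewrite mxE mulrA. Qed.

Lemma dotNl x y : dot (- x) y = - dot x y.
Proof. by rewrite -scaleN1r dotZl mulN1r. Qed.

Lemma dotBl x y z : dot (x - y) z = dot x z - dot y z.
Proof. by rewrite dotDl dotNl. Qed.

Lemma dotDr x y z : dot z (x + y) = dot z x + dot z y.
Proof. by rewrite dotC dotDl !(dotC z). Qed.

Lemma dotZr a x y : dot y (a *: x) = a * dot y x.
Proof. by rewrite dotC dotZl dotC. Qed.

Lemma dotNr x y : dot y (- x) = - dot y x.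
Proof. by rewrite dotC dotNl dotC. Qed.

Lemma dotBr x y z : dot z (x - y) = dot z x - dot z y.
Proof. by rewrite dotDr dotNr. Qed.

Lemma dot_ge0 x : 0 <= dot x x.
Proof. by apply: sumr_ge0 => i _; rewrite -expr2 sqr_ge0. Qed.

Lemma enorm_ge0 x : 0 <= enorm x.
Proof. exact: sqrtr_ge0. Qed.

Lemma sqr_enorm x : enorm x ^+ 2 = dot x x.
Proof. by rewrite sqr_sqrtr ?dot_ge0. Qed.

Lemma enorm0 : enorm (0 : 'rV[R]_d) = 0.
Proof. by rewrite /enorm /dot big1 ?sqrtr0// => i _; rewrite mxE mul0r. Qed.

Lemma enormZ a x : enorm (a *: x) = `|a| * enorm x.
Proof.
by rewrite /enorm dotZl dotZr mulrA -expr2 sqrtrM ?sqr_ge0// sqrtr_sqr.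
Qed.

Lemma enormN x : enorm (- x) = enorm x.
Proof. by rewrite -scaleN1r enormZ normrN1 mul1r. Qed.

Lemma enormB x y : enorm (x - y) = enorm (y - x).
Proof. by rewrite -enormN opprB. Qed.

Lemma enorm_eq0 x : enorm x = 0 -> x = 0.
Proof.
move=> x0; have : dot x x = 0 by rewrite -sqr_enorm x0 expr0n.
move=> /psumr_eq0P x0'; apply/rowP => i; rewrite mxE; apply/eqP.
have sq_ge0 j : true -> 0 <= x 0 j * x 0 j by rewrite -expr2 sqr_ge0.
by have /eqP := x0' sq_ge0 i isT; rewrite -expr2 sqrf_eq0.
Qed.

Lemma dot_le x y : dot x y <= enorm x * enorm y.
Proof.
have [y0|y0] := eqVneq (enorm y) 0.
  by rewrite (enorm_eq0 y0) -(scale0r 0) dotZr mul0r mulr_ge0 ?enorm_ge0.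
have [x0|x0] := eqVneq (enorm x) 0.
  by rewrite (enorm_eq0 x0) -(scale0r 0) dotZl mul0r mulr_ge0 ?enorm_ge0.
have xy0 : 0 < 2 * (enorm x * enorm y).
  by rewrite !mulr_gt0// lt_def ?x0 ?y0 enorm_ge0.
rewrite -subr_ge0 -(pmulr_rge0 _ xy0).
have := dot_ge0 (enorm y *: x - enorm x *: y).
rewrite dotBl !dotBr !dotZl !dotZr (dotC y x) -!sqr_enorm.
by congr (0 <= _); ring.
Qed.

Lemma enormD x y : enorm (x + y) <= enorm x + enorm y.
Proof.
rewrite -(@ler_pXn2r _ 2)// ?nnegrE ?addr_ge0 ?enorm_ge0//.
rewrite sqrrD !sqr_enorm dotDl !dotDr (dotC y x).
have := dot_le x y; lra.
Qed.

Lemma enorm_triangle z x y : enorm (x - y) <= enorm (x - z) + enorm (z - y).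
Proof. by rewrite -[in leLHS](subrK z x) -addrA enormD. Qed.

Lemma ler_enorm_sum (I : Type) (s : seq I) (P : pred I) (F : I -> 'rV[R]_d) :
  enorm (\sum_(i <- s | P i) F i) <= \sum_(i <- s | P i) enorm (F i).
Proof.
elim/big_ind2: _ => [|x a y b xa yb|//]; first by rewrite enorm0.
by rewrite (le_trans (enormD _ _))// lerD.
Qed.

End Euclidean.

(** * Smooth functions and their averages *)

Section Smooth.
Context {R : realType} {d : nat}.
Implicit Types (f : 'rV[R]_d -> R) (x y v : 'rV[R]_d).

Lemma derive_dot_grad f x v : differentiable f x -> 'D_v f x = dot (grad f x) v.
Proof.
move=> fx; rewrite deriveE// {1}(row_sum_delta v) linear_sum.
by apply: eq_bigr => i _; rewrite linearZ /= mxE deriveE//= mulrC.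
Qed.

(** The mean value theorem along the segment gives the constant [L], instead of the [L / 2] that
    integration would give; the later margins absorb the loss. *)
Lemma smooth_linearization L f x v : smooth L f ->
  `|f (x + v) - f x - dot (grad f x) v| <= L * enorm v ^+ 2.
Proof.
move=> [fd fL].
pose phi t := f (x + t *: v).
have dphi (t : R) : is_derive t 1 phi (dot (grad f (x + t *: v)) v).
  have quotE : (fun s : R => s^-1 *: ((phi \o shift t) (s *: 1) - phi t)) =
      (fun s => s^-1 *: ((f \o shift (x + t *: v)) (s *: v) - f (x + t *: v))).
    apply/funext => s; rewrite /phi /=; congr (_ *: (f _ - _)).
    by rewrite [s *: 1]mulr1 scalerDl addrCA.
  have dv : derivable f (x + t *: v) v by exact: diff_derivable.
  split; first by rewrite /derivable quotE.
  by rewrite /derive quotE -derive_dot_grad.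
have [|t] := @MVT R phi _ 0 1 ltr01 (fun t _ => dphi t).
  apply: continuous_subspaceT => t.
  by apply: differentiable_continuous; apply/derivable1_diffP; have [] := dphi t.
rewrite in_itv /= => /andP[t0 t1].
rewrite /phi scale1r scale0r addr0 subr0 mulr1 => ->; rewrite -dotBl.
set w := grad f _ - _.
have wL : enorm w <= L * enorm v.
  rewrite (le_trans (fL _ _))// addrAC subrr add0r enormZ gtr0_norm//.
  (* The sign of [L] is unknown here, but this product bounds a norm. *)
  have L0 : 0 <= L * enorm v.
    have := le_trans (enorm_ge0 _) (fL (x + v) x).
    by rewrite addrAC subrr add0r.
  by rewrite mulrCA ler_piMl// ltW.
have wv : enorm w * enorm v <= L * enorm v ^+ 2.
  by rewrite expr2 mulrA ler_wpM2r ?enorm_ge0.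
rewrite ler_norml lerNl -dotNl; apply/andP; split; apply: le_trans wv.
  by rewrite -(enormN w) dot_le.
exact: dot_le.
Qed.

(** Smoothness is assumed of the components of [g] only; this transfers it to [g] with the same
    constant, by linearity of the gradient and the triangle inequality. *)
Lemma smooth_average L n (f : 'I_n -> 'rV[R]_d -> R) (g : 'rV[R]_d -> R) :
  (0 < n)%N -> (forall x, g x = n%:R^-1 * \sum_i f i x) ->
  (forall i, smooth L (f i)) -> smooth L g.
Proof.
move=> n0 gE fL.
have n0' : 0 < n%:R :> R by rewrite ltr0n.
have -> : g = n%:R^-1 *: \sum_i f i.
  by apply/funext => x; rewrite gE /GRing.scale /= fct_sumE.
have dsum x : differentiable (\sum_i f i) x.
  by apply: differentiable_sum => i; apply: (fL i).1.
split=> [x|x y]; first exact: differentiableZ.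
have gradE z : grad (n%:R^-1 *: \sum_i f i) z = n%:R^-1 *: \sum_i grad (f i) z.
  apply/rowP => j; rewrite !mxE summxE deriveZ; last exact: diff_derivable.
  rewrite derive_sum; last by move=> i; apply: diff_derivable; apply: (fL i).1.
  by congr (_ * _); apply: eq_bigr => i _; rewrite mxE.
rewrite !gradE -scalerBr -sumrB enormZ ger0_norm ?invr_ge0 ?ler0n//.
rewrite ler_pdivrMl// (le_trans (ler_enorm_sum _ _ _))//.
rewrite (le_trans (ler_sum _ (fun i _ => (fL i).2 x y)))//.
by rewrite sumr_const card_ord mulr_natl.
Qed.

End Smooth.

(** Balls are convex, so the output of an epoch inherits any distance bound common to its inner
    iterates. *)
Lemma enorm_average_sub (R : realType) (d T : nat) (x : nat -> 'rV[R]_d) z rho :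
  (0 < T)%N -> (forall t, (0 < t <= T)%N -> enorm (x t - z) <= rho) ->
  enorm (T%:R^-1 *: \sum_(1 <= t < T.+1) x t - z) <= rho.
Proof.
move=> T0 xz; have T0' : 0 < T%:R :> R by rewrite ltr0n.
have -> : z = T%:R^-1 *: \sum_(1 <= t < T.+1) z.
  by rewrite sumr_const_nat subn1 -[X in _ *: X]scaler_nat scalerA mulVf ?scale1r ?gt_eqF.
rewrite -scalerBr -sumrB enormZ ger0_norm ?invr_ge0 ?ler0n// ler_pdivrMl//.
rewrite (le_trans (ler_enorm_sum _ _ _))//.
have -> : T%:R * rho = \sum_(1 <= t < T.+1) rho.
  by rewrite sumr_const_nat subn1 mulr_natl.
by apply: ler_sum_nat => t /xz.
Qed.

(** * Closed form of an SVRG step *)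

Section Argmin.
Context {R : realType} {d : nat}.

Lemma argmin_quadratic_growth (phi : 'rV[R]_d -> R) (A : R) y0 : 0 < A ->
  (forall z, phi (y0 + z) = phi y0 + A * enorm z ^+ 2) -> argmin phi = y0.
Proof.
move=> A0 phiE; have phi_le z : phi y0 <= phi z.
  by rewrite -(subrKC y0 z) phiE lerDl mulr_ge0 ?sqr_ge0 ?ltW.
apply: xget_unique => // y /(_ y0).
rewrite -[in phi y](subrKC y0 y) phiE gerDl pmulr_rle0// => y_le.
apply/eqP; rewrite -subr_eq0; apply/eqP/enorm_eq0/eqP.
by rewrite -sqrf_eq0 eq_le y_le sqr_ge0.
Qed.

Lemma svrg_stepE (mu eta gamma : R) (xk v x : 'rV[R]_d) :
  0 < mu -> 0 < eta -> 0 <= gamma ->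
  svrg_step mu eta gamma xk v x =
  (eta^-1 + mu^-1 + gamma)^-1 *: (eta^-1 *: x - v + gamma *: xk).
Proof.
move=> mu0 eta0 gamma0; set A := _ + gamma; set y := A^-1 *: _.
have A0 : 0 < A by rewrite !ltr_wpDr// ?invr_gt0// invr_ge0 ltW.
apply: (@argmin_quadratic_growth _ (A / 2)); first by rewrite divr_gt0.
move=> z; rewrite !sqr_enorm.
(* The optimality condition defining [y], tested against [z]: it cancels the terms linear in [z]. *)
have vz : dot v z = eta^-1 * dot x z + gamma * dot xk z - A * dot y z.
  rewrite /y !(dotZl, dotDl, dotNl) mulrA divff ?mul1r ?gt_eqF//; ring.
rewrite !(dotDl, dotDr, dotNl, dotNr) !(dotC z) vz /A !invfM.
rewrite (dotC y x) (dotC y xk).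
by set e := eta^-1; set m := mu^-1; field.
Qed.

End Argmin.

(** At [x_k], this is the gradient of the k-th subproblem. *)
Definition dc_residual (R : realType) (d : nat) (g h : 'rV[R]_d -> R) (mu : R)
    (p : 'rV[R]_d -> 'rV[R]_d) (x : 'rV[R]_d) : 'rV[R]_d :=
  grad g x + mu^-1 *: (x - p x) - grad h x.

(** * Displacement produced by one stage *)

Section StageDisplacement.
Context {R : realType} {d n1 : nat}.
Variables (gi : 'I_n1 -> 'rV[R]_d -> R) (g h : 'rV[R]_d -> R).
Variables (mu L gamma : R) (p : 'rV[R]_d -> 'rV[R]_d) (xk : 'rV[R]_d).
Hypotheses (L_gt0 : 0 < L) (mu_gt0 : 0 < mu) (gamma_ge0 : 0 <= gamma).
Hypotheses (gi_smooth : forall i, smooth L (gi i)) (g_smooth : smooth L g).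

Let eta := 5 / 100 / L.
Let u := dc_residual g h mu p xk.
Let sigma := mu^-1 + gamma.
Let inner := svrg_inner gi g h mu eta p gamma xk.

Let eta_gt0 : 0 < eta. Proof. by rewrite !divr_gt0. Qed.

Let etaV : eta^-1 = 20 * L.
Proof. by rewrite /eta; field; rewrite gt_eqF. Qed.

Let sigma_gt0 : 0 < sigma.
Proof. by rewrite ltr_wpDr// invr_gt0. Qed.

Let A_gt0 : 0 < 20 * L + sigma.
Proof. by rewrite addr_gt0// mulr_gt0. Qed.

(* Estimated from [xk], the SVRG direction is the residual [u] up to an error
   [e] controlled for every draw, not just in expectation. *)
Lemma svrg_innerS xbar idx t : exists2 e,
  enorm e <= L * enorm (inner xbar idx t - xbar) + L * enorm (xbar - xk) &
  inner xbar idx t.+1 - xk =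
  (20 * L + sigma)^-1 *: ((20 * L) *: (inner xbar idx t - xk) - u - e).
Proof.
set x := inner xbar idx t; pose i := idx t.+1.
exists (grad (gi i) x - grad (gi i) xbar + (grad g xbar - grad g xk)).
  apply: (le_trans (enormD _ _)); apply: lerD; first exact: (gi_smooth i).2.
  exact: g_smooth.2.
rewrite /inner /= -/inner -/x -/i svrg_stepE// etaV -addrA -/sigma.
rewrite /u /dc_residual; apply/rowP => j; rewrite !mxE.
have A0 : 20 * L + sigma != 0 by rewrite gt_eqF.
apply: (mulfI A0); rewrite mulrBr !mulrA divff// !mul1r /sigma; ring.
Qed.

Section LargeModulus.
Hypothesis sigma_large : 240 * L <= sigma.
(* [q] is the fixed point of [v |-> (20 L v - u) / (20 L + sigma)], that is of
   the displacement recursion without its error term. *)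
Let q := (- sigma^-1) *: u.

Let q_tenth : enorm q / 10 <= enorm q.
Proof. by rewrite ler_pdivrMr// ler_peMr ?enorm_ge0// ler1n. Qed.

(** A step multiplies the distance to the fixed point by [20 L / (20 L + sigma)]. In the ball of
    radius [|q|] about [x_k + q], two points are at most [2 |q|] apart, so the error is at most
    [4 L |q|]. Since [240 L <= sigma], the total [24 L |q| / (20 L + sigma)] is at most [|q| / 10],
    and the ball is mapped into a smaller one. *)
Lemma svrg_inner_close xbar idx t : enorm (xbar - xk - q) <= enorm q ->
  enorm (inner xbar idx t - xk - q) <= enorm q /\
  enorm (inner xbar idx t.+1 - xk - q) <= enorm q / 10.
Proof.
move=> xbarq.
have step s : enorm (inner xbar idx s - xk - q) <= enorm q ->
    enorm (inner xbar idx s.+1 - xk - q) <= enorm q / 10.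
  set x := inner xbar idx s => xq.
  have [e e_le ->] := svrg_innerS xbar idx s; rewrite -/x in e_le *.
  have -> : (20 * L + sigma)^-1 *: ((20 * L) *: (x - xk) - u - e) - q =
      (20 * L + sigma)^-1 *: ((20 * L) *: (x - xk - q) - e).
    have -> : (20 * L) *: (x - xk) - u - e =
        (20 * L) *: (x - xk - q) - e + (20 * L + sigma) *: q.
      have -> : u = - sigma *: q.
        by rewrite scalerA mulrNN divff ?scale1r ?gt_eqF.
      by move: (q) (e) => q' e'; apply/rowP => j; rewrite !mxE; ring.
    by rewrite scalerDr scalerA mulVf ?gt_eqF// scale1r addrK.
  have xxbar : enorm (x - xbar) <= 2 * enorm q.
    have -> : x - xbar = (x - xk - q) - (xbar - xk - q).
      by apply/rowP => j; rewrite !mxE; ring.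
    by have := enormD (x - xk - q) (- (xbar - xk - q)); rewrite enormN; lra.
  have xbarxk : enorm (xbar - xk) <= 2 * enorm q.
    by have := enormD (xbar - xk - q) q; rewrite subrK; lra.
  rewrite enormZ gtr0_norm ?invr_gt0// ler_pdivrMl//.
  rewrite (le_trans (enormD _ _))// enormN enormZ gtr0_norm ?mulr_gt0//.
  have q0 := enorm_ge0 q.
  have : 20 * L * enorm (x - xk - q) <= 20 * L * enorm q.
    by rewrite ler_wpM2l ?mulr_ge0// ltW.
  have : L * enorm (x - xbar) <= L * (2 * enorm q) by rewrite ler_wpM2l// ltW.
  have : L * enorm (xbar - xk) <= L * (2 * enorm q) by rewrite ler_wpM2l// ltW.
  have : 240 * L * enorm q <= sigma * enorm q by exact: ler_wpM2r.
  have Lq0 : 0 <= L * enorm q by rewrite mulr_ge0// ltW.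
  lra.
have inner_le s : enorm (inner xbar idx s - xk - q) <= enorm q.
  elim: s => [|s IH]; last exact: le_trans (step s IH) q_tenth.
  by have -> : inner xbar idx 0 = xbar by [].
by split; [exact: inner_le|apply: step; exact: inner_le].
Qed.

(** The first anchor [x_k] lies on the boundary of the invariant ball; one epoch brings it within
    [|q| / 10] of the centre, and later epochs keep it there. *)
Lemma svrg_close idx T S : (0 < T)%N -> (0 < S)%N ->
  enorm (svrg gi g h mu eta p gamma xk idx T S - xk - q) <= enorm q / 10.
Proof.
move=> T0; case: S => // S _.
have epoch xbar i : enorm (xbar - xk - q) <= enorm q ->
    enorm (svrg_epoch gi g h mu eta p gamma xk xbar i T - xk - q) <= enorm q / 10.
  move=> xbarq; rewrite -addrA -opprD; apply: enorm_average_sub => // t /andP[].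
  by case: t => // t _ _; rewrite opprD addrA; have [] := svrg_inner_close i t xbarq.
elim: S => [|S IH]; apply: epoch.
  by rewrite /= subrr add0r enormN.
exact: le_trans IH q_tenth.
Qed.

End LargeModulus.

(** Without a large modulus there is no contraction, but growth stays geometric. The factor 4 per
    inner step comes from [21 L + 20 L <= 4 * 20 L]. *)
Lemma svrg_crude_bound idx T S : (0 < T)%N ->
  enorm (svrg gi g h mu eta p gamma xk idx T S - xk) <=
  (4 ^+ T + 1) ^+ S * (enorm u / (20 * L)).
Proof.
move=> T0; set U := enorm u / _.
have L20 : 0 < 20 * L by rewrite mulr_gt0.
have U0 : 0 <= U by rewrite divr_ge0 ?enorm_ge0 ?ltW.
have inner_le xbar i t : enorm (inner xbar i t - xk) <= 4 ^+ t * (enorm (xbar - xk) + U).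
  have xbar0 := enorm_ge0 (xbar - xk).
  elim: t => [|t IH]; first by rewrite expr0 mul1r lerDl.
  have [e e_le ->] := svrg_innerS xbar i t.
  set x := inner xbar i t in IH e_le *.
  rewrite enormZ gtr0_norm ?invr_gt0// ler_pdivrMl//.
  set X := enorm (xbar - xk) + U in IH *.
  have X4 : X <= 4 ^+ t * X by rewrite ler_peMl ?addr_ge0// exprn_ege1// ler1n.
  have X0 : 0 <= X by rewrite addr_ge0.
  have u_le : enorm u = 20 * L * U by rewrite /U mulrC divfK// gt_eqF.
  have := enormD (20 * L *: (x - xk)) (- u - e).
  have := enormD (- u) (- e); rewrite !enormN enormZ gtr0_norm// u_le => ue xue.
  have xxb : enorm (x - xbar) <= enorm (x - xk) + enorm (xbar - xk).
    by rewrite (enormB xbar xk) enorm_triangle.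
  have xxb' : L * enorm (x - xbar) <= L * (enorm (x - xk) + enorm (xbar - xk)).
    by rewrite ler_wpM2l// ltW.
  have IH' : 21 * L * enorm (x - xk) <= 21 * L * (4 ^+ t * X).
    by rewrite ler_wpM2l// mulr_ge0// ltW.
  have X4' : 20 * L * X <= 20 * L * (4 ^+ t * X) by rewrite ler_wpM2l// ltW.
  have s0 : 0 <= sigma * (4 ^+ t.+1 * X).
    by apply: mulr_ge0; [exact: ltW|rewrite mulr_ge0 ?exprn_ge0].
  have LX0 : 0 <= L * (4 ^+ t * X) by rewrite (mulr_ge0 (ltW L_gt0))// (le_trans X0).
  have LU0 : 0 <= L * U by rewrite (mulr_ge0 (ltW L_gt0)).
  rewrite -addrA (le_trans xue)// [leRHS]mulrDl (le_trans _ (lerD (lexx _) s0))//.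
  rewrite addr0 exprS; have Lxbar0 : 0 <= L * enorm (xbar - xk) by rewrite (mulr_ge0 (ltW L_gt0)).
  rewrite -(mulrA 4); set E := 4 ^+ t * X in X4' IH' LX0 *.
  rewrite /X in X4'; lra.
have epoch xbar i : enorm (svrg_epoch gi g h mu eta p gamma xk xbar i T - xk) <=
    4 ^+ T * (enorm (xbar - xk) + U).
  apply: enorm_average_sub => // t /andP[_ tT].
  rewrite (le_trans (inner_le _ _ _))// ler_wpM2r ?addr_ge0 ?enorm_ge0//.
  by rewrite ler_weXn2l// ler1n.
(* Adding [U] turns the affine recursion over epochs into a geometric one. *)
suff : enorm (svrg gi g h mu eta p gamma xk idx T S - xk) + U <= (4 ^+ T + 1) ^+ S * U.
  by apply: le_trans; rewrite lerDl.
elim: S => [|S IH] /=; first by rewrite subrr enorm0 add0r expr0 mul1r.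
rewrite exprS -mulrA (le_trans _ (ler_wpM2l _ IH)) ?addr_ge0 ?exprn_ge0//.
by rewrite mulrDl mul1r lerD ?epoch// lerDr enorm_ge0.
Qed.

End StageDisplacement.

(** Neighbourhoods are given by sup-norm balls; this crude comparison turns them into Euclidean
    estimates. *)
Lemma enorm_le_coord (R : realType) (d : nat) (x : 'rV[R]_d) e :
  (forall i, `|x 0 i| <= e) -> enorm x <= d%:R * e.
Proof.
move=> xe; rewrite (row_sum_delta x) (le_trans (ler_enorm_sum _ _ _))//.
rewrite -[X in X%:R]card_ord mulr_natl -sumr_const ler_sum// => i _.
rewrite enormZ [X in _ * X](_ : _ = 1) ?mulr1//.
rewrite /enorm /dot (bigD1 i)//= big1 ?addr0 => [|j ji].
  by rewrite !mxE !eqxx mulr1 sqrtr1.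
by rewrite !mxE (negPf ji) andbF mulr0.
Qed.

(** * Proximal points and Frechet subgradients *)

Section Prox.
Context {R : realType} {d : nat}.
Variables (r : 'rV[R]_d -> \bar R) (mu : R).
Hypotheses (r_proper : proper_fun r) (mu_gt0 : 0 < mu).

Lemma moreau_prox x w : prox mu r x w -> moreau mu r x = prox_objective mu r x w.
Proof.
move=> xw; apply/eqP; rewrite eq_le; apply/andP; split.
  by apply: ereal_inf_lbound; exists w.
by apply: le_ereal_inf_tmp => _ [y _ <-]; exact: xw.
Qed.

Lemma prox_fin_num x w : prox mu r x w -> r w \is a fin_num.
Proof.
move=> xw; have [rNy [y ry]] := r_proper.
rewrite fin_numE rNy /=; apply: contraTneq ry => rw.
have := xw y; rewrite /prox_objective rw addey// leye_eq.
by case: (r y) (rNy y).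
Qed.

Lemma prox_le x w y : prox mu r x w -> r y \is a fin_num ->
  (2 * mu)^-1 * enorm (w - x) ^+ 2 + fine (r w) <=
  (2 * mu)^-1 * enorm (y - x) ^+ 2 + fine (r y).
Proof.
move=> xw ry; have := xw y; rewrite /prox_objective.
by rewrite -(fineK ry) -(fineK (prox_fin_num xw)) -!EFinD lee_fin.
Qed.

(** Expanding the minimality of [w] against [y], the linearization error of [r] at [w] is at least
    [- |y - w|^2 / (2 mu)], which is negligible with respect to [|y - w|]. *)
Lemma prox_frechet_subdiff x w : prox mu r x w ->
  frechet_subdiff r w (mu^-1 *: (x - w)).
Proof.
move=> xw; rewrite /frechet_subdiff /= /limf_einf oppe_ge0.
apply/lee_addgt0Pr => e e0; rewrite add0e.
have rw := prox_fin_num xw.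
(* On [V], the quadratic error divided by [|y - w|] is at most [e]. *)
pose V := [set y | y != w /\ enorm (y - w) <= 2 * mu * e].
apply: (@le_trans _ _ (ereal_sup ((fun y => - ((r y - r w -
    (dot (mu^-1 *: (x - w)) (y - w))%:E) * (enorm (y - w))^-1%:E))%E @` V))).
  apply: ereal_inf_lbound; exists V => //.
  (* The denominator pays for the factor [d] of [enorm_le_coord]; [+ 1] covers [d = 0]. *)
  apply/nbhs_ballP; exists (2 * mu * e / (d%:R + 1)).
    by rewrite /= divr_gt0 ?mulr_gt0// ltr_wpDl.
  move=> y [_ wy] yw; split=> //.
  apply: (@le_trans _ _ (d%:R * (2 * mu * e / (d%:R + 1)))).
    apply: enorm_le_coord => i; rewrite !mxE distrC ltW//; exact: wy.
  rewrite mulrCA ler_piMr ?mulr_ge0 ?(ltW e0) ?(ltW mu_gt0)// ler_pdivrMr ?ltr_wpDl//.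
  by rewrite mul1r lerDl.
apply: ge_ereal_sup => _ [y [yw ye] <-].
have yw0 : 0 < enorm (y - w).
  rewrite lt_def enorm_ge0 andbT; apply: contra_neq yw => /enorm_eq0.
  by move/eqP; rewrite subr_eq0 => /eqP.
have [ry|] := boolP (r y \is a fin_num); last first.
  have [rNy _] := r_proper; rewrite fin_numE rNy negbK /= => /eqP ->.
  by rewrite -(fineK rw) -!EFinN !addye// mulyr gtr0_sg ?invr_gt0// mul1e leNye.
rewrite -(fineK ry) -(fineK rw) -!(EFinN, EFinD, EFinM) lee_fin.
rewrite -mulNr ler_pdivrMr// dotZl.
have := prox_le xw ry.
have -> : y - x = (y - w) - (x - w).
  by apply/rowP => j; rewrite !mxE; ring.
rewrite (enormB w); set a := y - w in ye yw0 *; set b := x - w; clearbody a b.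
have m0 : mu^-1 * (enorm a * enorm a) <= 2 * e * enorm a.
  by rewrite mulrA ler_wpM2r ?enorm_ge0// ler_pdivrMl//; lra.
rewrite -expr2 in m0; rewrite [enorm (a - b) ^+ 2]sqr_enorm.
rewrite dotBl !dotBr (dotC a b) -!sqr_enorm invfM; lra.
Qed.

End Prox.

(** A real-valued form of [smoothed], with the envelope evaluated at the selection [p]; [smoothedE]
    relates the two. *)
Definition dc_objective (R : realType) (d : nat) (g h : 'rV[R]_d -> R)
    (r : 'rV[R]_d -> \bar R) (mu : R) (p : 'rV[R]_d -> 'rV[R]_d) x : R :=
  g x - h x + ((2 * mu)^-1 * enorm (p x - x) ^+ 2 + fine (r (p x))).

(** * Descent of the smoothed objective *)

Section DCObjective.
Context {R : realType} {d : nat}.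
Variables (g h : 'rV[R]_d -> R) (r : 'rV[R]_d -> \bar R) (mu L : R).
Variable p : 'rV[R]_d -> 'rV[R]_d.
Hypotheses (r_proper : proper_fun r) (mu_gt0 : 0 < mu) (L_gt0 : 0 < L).
Hypotheses (g_smooth : smooth L g) (h_smooth : smooth L h).
Hypothesis p_prox : forall x, prox mu r x (p x).

Let F := dc_objective g h r mu p.
Let u := dc_residual g h mu p.

Lemma smoothedE x : smoothed g h r mu x = (F x)%:E.
Proof.
rewrite /smoothed (moreau_prox (p_prox x)) /prox_objective.
by rewrite -(fineK (prox_fin_num r_proper (p_prox x))) -!EFinD.
Qed.

Lemma stationarity_gap_le x : (stationarity_gap g h r (p x) <=
  (enorm (u x) + 2 * L * enorm (x - p x))%:E)%E.
Proof.
apply: (@le_trans _ _ (enorm (grad h (p x) -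
    (grad g (p x) + mu^-1 *: (x - p x))))%:E).
  apply: ereal_inf_lbound; exists (grad h (p x)) => //.
  exists (grad g (p x) + mu^-1 *: (x - p x)) => //.
  by exists (mu^-1 *: (x - p x)) => //; exact: prox_frechet_subdiff.
rewrite lee_fin; set v := mu^-1 *: (x - p x).
have -> : grad h (p x) - (grad g (p x) + v) =
    - u x + ((grad g x - grad g (p x)) - (grad h x - grad h (p x))).
  rewrite /u /dc_residual -/v; clearbody v.
  move: (grad g x) (grad g (p x)) (grad h x) (grad h (p x)) => a b a' b'.
  by apply/rowP => j; rewrite !mxE; ring.
apply: (le_trans (enormD _ _)); rewrite enormN lerD2l -mulrA mulr2n mulrDl mul1r.
apply: (le_trans (enormD _ _)); rewrite enormN; apply: lerD.
  exact: g_smooth.2.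
exact: h_smooth.2.
Qed.

(** The point [p x] competes in the minimum defining the envelope at [x + v]; expanding its proximal
    term gives the part [(x - p x) / mu] of [u x]. The linearizations of [g] and [h] cost [L]
    each. *)
Lemma dc_objective_descent x v : F (x + v) <=
  F x + dot (u x) v + (2 * L + (2 * mu)^-1) * enorm v ^+ 2.
Proof.
have := smooth_linearization x v g_smooth.
have := smooth_linearization x v h_smooth.
rewrite !ler_norml => /andP[h_le _] /andP[_ g_le].
have := prox_le r_proper (p_prox (x + v)) (prox_fin_num r_proper (p_prox x)).
rewrite /F /dc_objective /u /dc_residual dotBl dotDl dotZl.
have -> : p x - (x + v) = (p x - x) - v by rewrite opprD addrA.
rewrite [enorm (p x - x - v) ^+ 2]sqr_enorm -(opprB (p x) x) dotNl.
move: (p x - x) => w; rewrite dotBl !dotBr (dotC v w) -!sqr_enorm invfM; lra.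
Qed.

(** In units of [|u|^2 / sigma], the linear term gains at least [9 / 10]. The curvature is at most
    [(1 / 120 + 1 / 2) sigma] and the step at most [11 / 10 |q|], so the quadratic term loses at
    most [61 / 120 * 121 / 100]; more than [1 / 5] remains. *)
Lemma dc_objective_decrease sigma x y : 240 * L <= sigma -> mu^-1 <= sigma ->
  let q := - sigma^-1 *: u x in enorm (y - x - q) <= enorm q / 10 ->
  F y <= F x - enorm (u x) ^+ 2 / (5 * sigma).
Proof.
move=> sL smu q; set e := y - x - q => e_le.
have s0 : 0 < sigma by rewrite (lt_le_trans _ smu)// invr_gt0.
have -> : y = x + (q + e) by rewrite /e addrC subrKC subrK.
apply: (le_trans (dc_objective_descent _ _)).
rewrite -addrA lerD2l.
have qE : enorm q = sigma^-1 * enorm (u x).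
  by rewrite /q enormZ normrN gtr0_norm ?invr_gt0.
have u0 := enorm_ge0 (u x); set U := enorm (u x) in u0 qE *.
have uq : dot (u x) (q + e) <= - (sigma^-1 * U ^+ 2) + sigma^-1 * U ^+ 2 / 10.
  rewrite dotDr dotZr -sqr_enorm mulNr lerD2l (le_trans (dot_le _ _))//.
  apply: (le_trans (ler_wpM2l u0 e_le)); rewrite -/U qE; lra.
have v_le : enorm (q + e) ^+ 2 <= (11 / 10 * (sigma^-1 * U)) ^+ 2.
  rewrite ler_pXn2r ?nnegrE ?enorm_ge0//; last by rewrite !mulr_ge0// invr_ge0 ltW.
  rewrite (le_trans (enormD _ _))//; lra.
have c_le : 2 * L + (2 * mu)^-1 <= 61 / 120 * sigma by rewrite invfM; lra.
apply: (@le_trans _ _ (- (9 / 10) * (sigma^-1 * U ^+ 2) +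
    61 / 120 * sigma * (11 / 10 * (sigma^-1 * U)) ^+ 2)).
  apply: lerD; first by move: uq; lra.
  apply: ler_pM => //; last exact: sqr_ge0.
  by rewrite addr_ge0 ?mulr_ge0 ?invr_ge0 ?mulr_ge0// ltW.
rewrite -subr_ge0.
have -> : - (U ^+ 2 / (5 * sigma)) - (- (9 / 10) * (sigma^-1 * U ^+ 2) +
    61 / 120 * sigma * (11 / 10 * (sigma^-1 * U)) ^+ 2) =
    (9 / 10 - 1 / 5 - 61 / 120 * (121 / 100)) * (sigma^-1 * U ^+ 2).
  by field; rewrite gt_eqF.
by rewrite mulr_ge0 ?mulr_ge0 ?sqr_ge0 ?invr_ge0 ?(ltW s0)//; lra.
Qed.

End DCObjective.

(** * Summing the decrease over the stages *)

Section Stages.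
Context {R : realType} {d n1 : nat}.
Variables (gi : 'I_n1 -> 'rV[R]_d -> R) (g h : 'rV[R]_d -> R).
Variables (r : 'rV[R]_d -> \bar R) (mu L Delta : R) (p : 'rV[R]_d -> 'rV[R]_d).
Variables (x1 : 'rV[R]_d) (gamma : nat -> R) (T S : nat -> nat).
Variable idx : nat -> nat -> nat -> 'I_n1.
Hypotheses (r_proper : proper_fun r) (L_gt0 : 0 < L) (mu_gt0 : 0 < mu).
Hypotheses (gi_smooth : forall i, smooth L (gi i)) (g_smooth : smooth L g).
Hypotheses (h_smooth : smooth L h) (p_prox : forall x, prox mu r x (p x)).
Hypotheses (gamma_ge0 : forall k, 0 <= gamma k).
Hypotheses (gamma_ndecr : forall k l, (k <= l)%N -> gamma k <= gamma l).
Hypothesis T_gt0 : forall k, (0 < k)%N -> (0 < T k)%N.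
Hypotheses (S1 : S 1 = 0) (S_gt0 : forall k, (1 < k)%N -> (0 < S k)%N).
Hypothesis mu_small : 240 * L <= mu^-1.
Hypothesis initial_gap : forall x, dc_objective g h r mu p x1 <=
  dc_objective g h r mu p x + Delta.

Let F := dc_objective g h r mu p.
Let u := dc_residual g h mu p.
Let x := stagewise gi g h mu (5 / 100 / L) p x1 gamma T S idx.
Let sigma k := mu^-1 + gamma k.

Let x2 : x 2 = x1. Proof. by rewrite /x /= S1. Qed.

Let mu_le_sigma k : mu^-1 <= sigma k. Proof. by rewrite lerDl. Qed.

Let sigma_gt0 k : 0 < sigma k.
Proof. by rewrite (lt_le_trans _ (mu_le_sigma k))// invr_gt0. Qed.

Let stage_decrease k : (1 < k)%N ->
  F (x k.+1) <= F (x k) - enorm (u (x k)) ^+ 2 / (5 * sigma k).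
Proof.
case: k => [//|[//|k]] _.
have sL : 240 * L <= sigma k.+2 by rewrite (le_trans mu_small).
apply: (dc_objective_decrease r_proper mu_gt0 L_gt0 g_smooth h_smooth p_prox) => //.
by apply: svrg_close => //; [exact: T_gt0|exact: S_gt0].
Qed.

Lemma stagewise_objective_le k : F (x k) <= F x1.
Proof.
elim: k => [|[|[|k]] IH] //; first by rewrite x2.
rewrite (le_trans (stage_decrease _))// (le_trans _ IH)// gerBl.
by rewrite divr_ge0 ?sqr_ge0// mulr_ge0// ltW.
Qed.

(** The decreases telescope once each [sigma k] is replaced by the last one. The term [k = 1] has no
    decrease of its own but equals the term [k = 2], whence 10 instead of 5. Telescoping is allowed
    up to stage [K + 1], so that the term [k = 2] is available even for [K = 1]. *)
Lemma stagewise_sum_residual K :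
  \sum_(1 <= k < K.+1) enorm (u (x k)) ^+ 2 <= 10 * sigma K.+1 * Delta.
Proof.
set s := sigma K.+1.
have s0 : 0 < s by exact: sigma_gt0.
have telescope m : (m <= K)%N ->
    \sum_(2 <= k < m.+2) enorm (u (x k)) ^+ 2 <= 5 * s * (F x1 - F (x m.+2)).
  elim: m => [_|m IH mK]; first by rewrite big_geq// x2 subrr mulr0.
  rewrite big_nat_recr//= (le_trans (lerD (IH (ltnW mK)) (lexx _)))//.
  have sm : sigma m.+2 <= s by rewrite lerD2l gamma_ndecr.
  have := stage_decrease (isT : 1 < m.+2)%N; rewrite lerBrDr.
  set U := enorm _ ^+ 2 => decr.
  have UE : U = 5 * sigma m.+2 * (U / (5 * sigma m.+2)).
    by rewrite mulrC divfK// mulf_neq0// gt_eqF.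
  have : 5 * sigma m.+2 * (U / (5 * sigma m.+2)) <= 5 * s * (U / (5 * sigma m.+2)).
    apply: ler_wpM2r; last by rewrite ler_wpM2l.
    by apply: divr_ge0; [exact: sqr_ge0|rewrite mulr_ge0// ltW].
  rewrite -UE => U_le; have s5 : 0 < 5 * s by rewrite mulr_gt0.
  by move: decr; rewrite -(ler_pM2l s5); lra.
have all_le m : (m <= K)%N ->
    \sum_(2 <= k < m.+2) enorm (u (x k)) ^+ 2 <= 5 * s * Delta.
  move=> /telescope /le_trans; apply; rewrite ler_pM2l ?mulr_gt0//.
  by rewrite lerBlDl initial_gap.
case: K @s s0 telescope all_le => [|K] s s0 _ all_le.
  by rewrite big_geq//; have := all_le 0%N isT; rewrite big_geq//; lra.
have u12 : enorm (u (x 1)) ^+ 2 <= 5 * s * Delta.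
  have := all_le 1%N isT; rewrite big_nat1 x2; exact.
by have := all_le K (leqnSn _); rewrite big_add1 [in X in _ -> X]big_nat_recl//=; lra.
Qed.

End Stages.

(** * Crude bounds when [mu] is bounded away from 0 *)

Lemma dc_residual_le (R : realType) d (g h : 'rV[R]_d -> R) mu L p x :
  0 < mu -> smooth L g -> smooth L h ->
  enorm (dc_residual g h mu p x) <=
  enorm (grad g 0) + enorm (grad h 0) + 2 * L * enorm x + mu^-1 * enorm (x - p x).
Proof.
move=> mu0 gL hL.
have grad_le (f : 'rV[R]_d -> R) : smooth L f ->
    enorm (grad f x) <= enorm (grad f 0) + L * enorm x.
  move=> fL; have := fL.2 x 0; rewrite subr0 -lerBlDl; apply: le_trans.
  by rewrite lerBlDl addrC; have := enorm_triangle (grad f 0) (grad f x) 0; rewrite !subr0.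
apply: (le_trans (enormD _ _)); rewrite enormN.
apply: (le_trans (lerD (enormD _ _) (grad_le h hL))).
rewrite enormZ gtr0_norm ?invr_gt0//; have {grad_le} := grad_le g gL.
move: (enorm (grad g x)) (enorm (grad g 0)) (enorm (grad h 0)) => a b b'.
by move: (_ * enorm (x - p x)) (enorm x) => c e; lra.
Qed.

(** Induction on the stage with [svrg_crude_bound]. The order of quantifiers matters: [B] is fixed
    before the decomposition of [g], the smoothing parameter, the selection and the draws. *)
Lemma stagewise_bounded (R : realType) (d : nat) (g h : 'rV[R]_d -> R)
    (r : 'rV[R]_d -> \bar R) (L Q M : R) (x1 : 'rV[R]_d) (gamma : nat -> R)
    (T S : nat -> nat) :
  0 < L -> smooth L h -> (forall k, 0 <= gamma k) -> 0 <= Q ->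
  (forall k, (0 < k)%N -> (0 < T k)%N) ->
  (forall mu x w, 0 < mu < 1 -> prox mu r x w ->
     enorm (x - w) <= Q * (1 + enorm x)) ->
  forall k, exists B : R, forall n1 (gi : 'I_n1 -> 'rV[R]_d -> R) mu p idx,
  0 < mu < 1 -> mu^-1 <= M -> (forall i, smooth L (gi i)) -> smooth L g ->
  (forall x, prox mu r x (p x)) ->
  enorm (stagewise gi g h mu (5 / 100 / L) p x1 gamma T S idx k) <= B.
Proof.
move=> L0 hL gamma0 Q0 T0 prox_growth; elim=> [|[_|k [B IH]]].
- by exists (enorm x1).
- by exists (enorm x1).
pose U := enorm (grad g 0) + enorm (grad h 0) + 2 * L * B + M * (Q * (1 + B)).
exists (B + (4 ^+ T k.+1 + 1) ^+ S k.+1 * (U / (20 * L))).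
move=> n1 gi mu p idx mu01 muM giL gL pP.
have {}IH := IH n1 gi mu p idx mu01 muM giL gL pP.
move: mu01 (prox_growth mu) => /andP[mu0 mu1] growth.
set xk := stagewise _ _ _ _ _ _ _ _ _ _ _ _ in IH.
rewrite -[X in enorm X](subrK xk) addrC (le_trans (enormD _ _))// lerD//.
apply: (le_trans (svrg_crude_bound h p xk L0 mu0 (gamma0 _) giL gL _ _ (T0 _ _))) => //.
rewrite ler_wpM2l ?exprn_ge0 ?addr_ge0 ?exprn_ge0//.
rewrite ler_wpM2r ?invr_ge0 ?mulr_ge0 ?(ltW L0)//.
apply: (le_trans (dc_residual_le p xk mu0 gL hL)); rewrite /U.
have xk0 := enorm_ge0 xk.
apply: lerD; first by rewrite lerD2l ler_wpM2l// mulr_ge0// ltW.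
apply: ler_pM; rewrite ?enorm_ge0 ?invr_ge0 ?(ltW mu0)//.
have mu01 : 0 < mu < 1 by rewrite mu0.
by rewrite (le_trans (growth _ _ mu01 (pP xk)))// ler_wpM2l// lerD2l.
Qed.

(** * Integrals of possibly non-measurable functions *)

Section LowerIntegral.
Import HBNNSimple.
Context {R : realType} {disp : measure_display} {Omega : measurableType disp}.
Variable P : probability Omega R.
Local Open Scope ereal_scope.

(* [f] need not be measurable: its integral is then a supremum over the simple
   functions below it. *)
Lemma integral_le_cover (I : choiceType) (s : seq I) (A : I -> set Omega)
    (b : I -> R) (f : Omega -> \bar R) :
  (forall j, measurable (A j)) -> (forall j, (0 <= b j)%R) ->
  (forall w, 0 <= f w) ->
  (forall j w, j \in s -> A j w -> f w <= (b j)%:E) ->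
  P (\bigcup_(j in [set` s]) A j) = 1 ->
  \int[P]_w f w <= \sum_(j <- s) (b j)%:E * P (A j).
Proof.
move=> mA b0 f0 fb P1; set C := \bigcup_(j in _) _ in P1.
have mC : measurable C.
  by apply: fin_bigcup_measurable => // j _; exact: mA.
have PN : P (~` C) = 0 by rewrite probability_setC// P1 subee.
pose term j : Omega -> \bar R := fun w => (b j)%:E * (\1_(A j) w)%:E.
pose g : Omega -> \bar R := fun w => \sum_(j <- s) term j w.
have mterm j : measurable_fun setT (term j).
  rewrite /term; under eq_fun do rewrite -EFinM.
  by apply/measurable_EFinP; apply: measurable_funM.
have term0 j w : 0 <= term j w.
  by rewrite /term -EFinM lee_fin mulr_ge0.
have mg : measurable_fun setT g by apply: emeasurable_sum.
have g0 w : 0 <= g w by apply: sume_ge0.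
have fg w : C w -> f w <= g w.
  move=> [j /= js Ajw]; rewrite (le_trans (fb j w js Ajw))// /g.
  rewrite (big_rem j)//= {1}/term indicE mem_set// mule1 leeDl//.
  by apply: sume_ge0 => ? _; exact: term0.
apply: (@le_trans _ _ (\int[P]_w g w)); last first.
  rewrite ge0_integral_sum//; apply: lee_sum => j _.
  rewrite ge0_integralZl_EFin//; last first.
    by apply/measurable_EFinP.
  by rewrite integral_indic// setIT.
rewrite ge0_integralTE//; apply: ge_ereal_sup => _ [k /= kf <-].
have mk : measurable_fun setT (EFin \o k).
  by apply/measurable_EFinP.
have k0 w : setT w -> 0 <= (k w)%:E by rewrite lee_fin.
rewrite -integralT_nnsfun (ge0_negligible_integral (measurableC mC))//.
have mD : measurable (setT `\` ~` C) by apply: measurableD => //; exact: measurableC.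
apply: (@le_trans _ _ (\int[P]_(w in setT `\` ~` C) g w)).
  apply: ge0_le_integral => //.
  - by move=> w _; exact: k0.
  - exact: measurable_funS mk.
  - exact: measurable_funS mg.
  - by move=> w [_ /contrapT Cw]; rewrite (le_trans (kf w))// fg.
by apply: ge0_subset_integral.
Qed.

End LowerIntegral.

(** * Averaging over the sampled index *)

Section Sampling.
Context {R : realType} {disp : measure_display} {Omega : measurableType disp}.
Variables (P : probability Omega R) (n1 : nat) (alpha : R) (K : nat).
Variables (T S : nat -> nat) (i : nat -> nat -> nat -> Omega -> 'I_n1).
Variable tau : Omega -> nat.
Hypotheses (n1_gt0 : (0 < n1)%N) (K_gt0 : (0 < K)%N).
Hypothesis samp : sampling P alpha K T S i tau.
Local Open Scope ereal_scope.

Definition stage_weight (k : nat) : R :=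
  (k%:R `^ alpha / \sum_(1 <= j < K.+1) j%:R `^ alpha)%R.

Lemma stage_weight_ge0 k : (0 <= stage_weight k)%R.
Proof. by rewrite divr_ge0 ?powR_ge0// sumr_ge0// => j _; exact: powR_ge0. Qed.

Lemma sum_stage_weight : (\sum_(1 <= k < K.+1) stage_weight k = 1)%R.
Proof.
rewrite -mulr_suml divff// gt_eqF// big_nat_recl//= powR1 ltr_pwDl//.
by apply: sumr_ge0 => j _; exact: powR_ge0.
Qed.

Let D (a : option (nat * nat * nat)) :=
  if a is Some b then draw_position K T S b else true.

Lemma draw_positions_finite :
  exists2 s : seq (nat * nat * nat), uniq s & s =i draw_position K T S.
Proof.
pose N := (\sum_(k < K.+1) (S k + T k)).+1.
pose v (a : 'I_K.+1 * 'I_N * 'I_N) := (val a.1.1, val a.1.2, val a.2).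
have v_inj : injective v.
  by move=> [[a b] c] [[a' b'] c'] [/val_inj-> /val_inj-> /val_inj->].
exists [seq a <- map v (enum predT) | draw_position K T S a].
  by rewrite filter_uniq// map_inj_uniq// enum_uniq.
move=> [[k s] t]; rewrite mem_filter.
apply: andb_idr => /= /and3P[/andP[_ kK] /andP[_ sS] /andP[_ tT]].
have kK' : (k < K.+1)%N by [].
have ST : (S k + T k <= \sum_(k < K.+1) (S k + T k))%N.
  by rewrite (bigD1 (Ordinal kK'))//= leq_addr.
have sN : (s < N)%N by rewrite ltnS (leq_trans sS)// (leq_trans _ ST)// leq_addr.
have tN : (t < N)%N by rewrite ltnS (leq_trans tT)// (leq_trans _ ST)// leq_addl.
by apply/mapP; exists (Ordinal kK', Ordinal sN, Ordinal tN); rewrite ?mem_enum.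
Qed.

(** Given the values [o] of all draws, [tau] keeps its law, so a weighted bound valid for every
    fixed sequence passes to the integral. The finitely many events [A (k, o)], on which [tau = k]
    and the draws are [o], cover almost all of [Omega]. *)
Lemma sampling_integral_le (f : Omega -> \bar R)
    (Psi : nat -> (nat -> nat -> nat -> 'I_n1) -> R) (B : R) :
  (forall w, 0 <= f w) -> (forall k idx, (0 <= Psi k idx)%R) ->
  (forall w, (1 <= tau w <= K)%N ->
    f w <= (Psi (tau w) (fun k s t => i k s t w))%:E) ->
  (forall k idx idx', (1 <= k <= K)%N ->
    (forall l s t, draw_position K T S (l, s, t) -> idx l s t = idx' l s t) ->
    Psi k idx = Psi k idx') ->
  (forall idx, (\sum_(1 <= k < K.+1) stage_weight k * Psi k idx <= B)%R) ->
  \int[P]_w f w <= B%:E.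
Proof.
move=> f0 Psi0 fPsi Psi_eq PsiB.
have [mX _ ptau indep] := samp; rewrite -/D in mX indep.
have [s us sD] := draw_positions_finite.
pose assignment := {ffun seq_sub s -> 'I_n1}.
(* The default index outside the draw positions is harmless: by [Psi_eq], [Psi] does not see it. *)
pose ext (o : assignment) k l t : 'I_n1 :=
  if insub (k, l, t) is Some a then o a else Ordinal n1_gt0.
pose val_of (o : assignment) (k : nat) (a : option (nat * nat * nat)) : set nat :=
  if a is Some (k', l, t) then [set nat_of_ord (ext o k' l t)] else [set k].
pose X := all_draws i tau.
pose E (o : assignment) := \bigcap_(a in [set` map Some s]) (X a @^-1` val_of o 0%N a).
pose A (j : nat * assignment) := (X None @^-1` [set j.1]) `&` E j.2.
have mE o : measurable (E o).
  apply: fin_bigcap_measurable => // a /mapP[b bs ->].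
  rewrite -[X in measurable X]setTI; apply: mX => //.
  by rewrite sD in bs.
have mtau k : measurable (X None @^-1` [set k]).
  by rewrite -[X in measurable X]setTI; apply: mX.
have mA j : measurable (A j) by apply: measurableI.
have allD : all D (map Some s).
  by apply/allP => _ /mapP[b bs ->]; rewrite sD in bs.
(* Independence is used twice: for [tau] together with the draws, then for the draws alone, to
   reassemble [P (E j.2)]. *)
have PA j : (1 <= j.1 <= K)%N -> P (A j) = (stage_weight j.1)%:E * P (E j.2).
  move=> jK.
  have -> : A j = \bigcap_(a in [set` None :: map Some s]) (X a @^-1` val_of j.2 j.1 a).
    apply/seteqP; split=> [w [/= tw Ew] [b|] /= bs|w Aw].
    - by have := Ew (Some b) bs; case: (b).
    - exact: tw.
    - split; first by apply: (Aw None); rewrite /= in_cons eqxx.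
      move=> [b|] /=; last by case/mapP.
      by move=> bs; have := Aw (Some b); rewrite /= in_cons bs orbT => /(_ isT); case: (b).
  rewrite indep/=; last 2 first.
  - rewrite map_inj_uniq ?us ?andbT; last by move=> ? ? [].
    by apply/negP => /mapP[].
  - exact: allD.
  rewrite big_cons [X in X * _]ptau//; congr (_ * _); rewrite indep//.
    by rewrite !big_map; apply: eq_bigr => -[[? ?] ?].
  by rewrite map_inj_uniq// => ? ? [].
have E_cover w : exists o, E o w.
  exists [ffun a => i (val a).1.1 (val a).1.2 (val a).2 w].
  move=> _ /mapP[[[k l] t] bs ->] /=.
  by rewrite /ext insubT/= ffunE.
have E_disjoint o o' : (E o `&` E o') !=set0 -> o = o'.
  move=> [w [Eo Eo']]; apply/ffunP => -[[[k l] t] a].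
  have bs : Some (k, l, t) \in map Some s by apply/mapP; exists (k, l, t).
  have := Eo _ bs; have := Eo' _ bs; rewrite /= /ext insubT => -> /= .
  by move/val_inj.
have sum_E : \sum_(o <- enum {: assignment}) P (E o) <= 1.
  rewrite fsbig_seq ?enum_uniq// -measure_fin_bigcup//.
  - apply: probability_le1; apply: fin_bigcup_measurable => // o _; exact: mE.
  - by move=> o o' _ _; exact: E_disjoint.
pose stages := index_iota 1 K.+1.
pose J := [seq (k, o) | k <- stages, o <- enum {: assignment}].
have PJ : P (\bigcup_(j in [set` J]) A j) = 1.
  have -> : \bigcup_(j in [set` J]) A j =
      \bigcup_(k in [set` stages]) (X None @^-1` [set k]).
    apply/seteqP; split=> w.
      by move=> [_ /= /allpairsP[[k o] [/= kK _ ->]] [/= tw _]]; exists k.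
    move=> [k /= kK tw]; have [q Eq] := E_cover w.
    by exists (k, q) => //=; apply/allpairsP; exists (k, q); rewrite mem_enum.
  rewrite measure_fin_bigcup; last first.
  - by move=> k _; exact: mtau.
  - by move=> k l _ _ [w [<- <-]].
  - exact: finite_seq.
  rewrite -fsbig_seq ?iota_uniq// -(sum_stage_weight).
  rewrite -sumEFin; apply: eq_big_nat => k kK; exact: ptau.
pose b (j : nat * assignment) := Psi j.1 (ext j.2).
have b0 j : (0 <= b j)%R by exact: Psi0.
have fb j w : j \in J -> A j w -> f w <= (b j)%:E.
  case: j => [_ o] /allpairsP[[k o'] [/= kK _ [-> ->]]] [tw /= Ew].
  rewrite /= in tw; rewrite mem_index_iota ltnS in kK.
  rewrite (le_trans (fPsi w _)) ?tw// lee_fin /b /= le_eqVlt; apply/orP; left.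
  apply/eqP; apply: Psi_eq => // l u t lut.
  have bs : Some (l, u, t) \in map Some s.
    by apply/mapP; exists (l, u, t); rewrite ?sD.
  by apply: val_inj; exact: Ew _ bs.
apply: (le_trans (integral_le_cover mA b0 f0 fb PJ)).
pose e o := fine (P (E o)).
have PE o : P (E o) = (e o)%:E by rewrite fineK// fin_num_measure.
have e0 o : (0 <= e o)%R by rewrite -lee_fin -PE.
(* Needed at the end, where the events [E o] are only known to have total probability at most 1. *)
have B0 : (0 <= B)%R.
  rewrite (le_trans _ (PsiB (fun=> fun=> fun=> Ordinal n1_gt0)))// sumr_ge0// => k _.
  by rewrite mulr_ge0 ?stage_weight_ge0.
rewrite big_allpairs_dep/= exchange_big/=.
have -> : \sum_(o <- enum {: assignment}) \sum_(k <- stages) (b (k, o))%:E * P (A (k, o)) =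
   (\sum_(o <- enum {: assignment}) (\sum_(k <- stages) stage_weight k * b (k, o)) * e o)%:E.
  rewrite -sumEFin; apply: eq_bigr => o _; rewrite mulr_suml -sumEFin.
  apply: eq_big_seq => k; rewrite mem_index_iota ltnS => kK.
  by rewrite PA// PE -!EFinM mulrCA mulrA.
rewrite lee_fin (@le_trans _ _ (\sum_(o <- enum {: assignment}) B * e o)%R)//.
  by apply: ler_sum => o _; rewrite ler_wpM2r//; exact: (PsiB (ext o)).
rewrite -mulr_sumr ler_piMr// -lee_fin -sumEFin.
by under eq_bigr do rewrite -PE.
Qed.

End Sampling.

(** * Rates in [eps] of the weights, moduli and complexity *)

Section Rates.
Context {R : realType}.
Implicit Types (alpha eps rho : R) (K m e k : nat).

(* Pairing [j] with [K + 1 - j], one of which is at least [K / 2]. *)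
Lemma sum_powR_ge alpha K : 0 <= alpha ->
  K%:R / 2 * (K%:R / 2) `^ alpha <= \sum_(1 <= j < K.+1) j%:R `^ alpha.
Proof.
move=> alpha0; set s := \sum_(_ <= _ < _) _.
have K0 : 0 <= K%:R / 2 :> R by rewrite divr_ge0.
have s2 : s + s = \sum_(1 <= j < K.+1) (j%:R `^ alpha + (K.+1 - j)%:R `^ alpha).
  by rewrite big_split/= -/s {2}/s big_nat_rev.
have : K%:R * (K%:R / 2) `^ alpha <= s + s.
  have -> : K%:R * (K%:R / 2) `^ alpha = \sum_(1 <= j < K.+1) (K%:R / 2) `^ alpha.
    by rewrite sumr_const_nat subn1 mulr_natl.
  rewrite s2; apply: ler_sum_nat => j /andP[j1 jK].
  have [jK2|jK2] := leP (K%:R / 2 : R) j%:R.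
    by rewrite ler_wpDr ?powR_ge0// ge0_ler_powR ?nnegrE.
  have KjE : (K.+1 - j)%:R = K%:R + 1 - j%:R :> R.
    by rewrite natrB ?natr1// ltnW.
  by rewrite ler_wpDl ?powR_ge0// ge0_ler_powR ?nnegrE// KjE; lra.
by move=> ?; lra.
Qed.

Lemma stage_weight_le alpha K k : 0 <= alpha -> (0 < K)%N -> (k <= K)%N ->
  stage_weight alpha K k <= 2 / (2^-1) `^ alpha / K%:R.
Proof.
move=> alpha0 K0 kK; have K0' : 0 < K%:R :> R by rewrite ltr0n.
have := sum_powR_ge K alpha0; rewrite powRM ?ler0n ?invr_ge0//.
set a := 2^-1 `^ alpha; set b := K%:R `^ alpha => s_ge.
have a0 : 0 < a by rewrite powR_gt0// invr_gt0.
have b0 : 0 < b by rewrite powR_gt0.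
have ab0 : 0 < K%:R / 2 * (b * a) by rewrite !mulr_gt0.
rewrite /stage_weight ler_pdivrMr ?(lt_le_trans ab0)//.
apply: (le_trans (ge0_ler_powR alpha0 (ler0n _ k) (ler0n _ K) _)); first by rewrite ler_nat.
have -> : K%:R `^ alpha = 2 / a / K%:R * (K%:R / 2 * (b * a)).
  by rewrite -/b; field; rewrite !gt_eqF.
by rewrite ler_wpM2l// !divr_ge0// ltW.
Qed.

Lemma exprn_gt0_lt1 eps m : (0 < m)%N -> 0 < eps < 1 -> 0 < eps ^+ m < 1.
Proof.
move=> m0 /andP[eps0 eps1].
by rewrite exprn_gt0//= exprn_ilt1 ?ltW// -lt0n.
Qed.

Lemma nceil_itv (x : R) : 0 < x -> x <= (nceil x)%:R < x + 1.
Proof.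
move=> x0; have : (nceil x)%:R = (Num.ceil x)%:~R :> R.
  by rewrite -[in RHS](@gez0_abs (Num.ceil x))// ltW// Num.Theory.ceil_gt0.
move=> ->; have := Num.Theory.ceil_itv x.
by rewrite intrB ltrBlDr andbC.
Qed.

(** As [eps^-1 ^+ e >= 1], rounding up at most doubles it. The number of stages is taken with
    constant 1. *)
Lemma nceil_inv_exp e eps : 0 < eps < 1 ->
  [/\ (0 < nceil (1 / eps ^+ e))%N, eps^-1 ^+ e <= (nceil (1 / eps ^+ e))%:R
    & (nceil (1 / eps ^+ e))%:R <= 2 * eps^-1 ^+ e].
Proof.
move=> /andP[eps0 eps1]; rewrite div1r -exprVn.
have V1 : 1 <= eps^-1 ^+ e by rewrite exprn_ege1// invf_ge1// ltW.
have V0 : 0 < eps^-1 ^+ e by rewrite (lt_le_trans ltr01).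
have /andP[ge lt] := nceil_itv V0; split=> //; last by move: lt V1; lra.
by rewrite -(ltr0n R) (lt_le_trans V0).
Qed.

(** The exponents are tuned for this: [(m + 2) rho = m] makes [K ^ rho] of order [eps ^ (- m)], like
    [1 / mu], and this is [eps ^ 2 K] up to a constant. The 3 comes from
    [K + 1 <= 3 eps ^ (- (m + 2))]. *)
Lemma stage_modulus_le c m rho eps (K := nceil (1 / eps ^+ m.+2)) :
  0 < eps < 1 -> 0 <= c -> 0 <= rho -> m.+2%:R * rho = m%:R ->
  (eps ^+ m)^-1 + c * K.+1%:R `^ rho <= (1 + c * 3 `^ rho) * eps ^+ 2 * K%:R.
Proof.
move=> eps01 c0 rho0 rhoE; have [K0 K_ge K_le] := nceil_inv_exp m.+2 eps01.
have /andP[eps0 eps1] := eps01; rewrite -/K in K0 K_ge K_le.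
have V1 : 1 <= eps^-1 ^+ m.+2 by rewrite exprn_ege1// invf_ge1// ltW.
have V0 : 0 <= eps^-1 by rewrite invr_ge0 ltW.
have mE : eps^-1 ^+ m <= eps ^+ 2 * K%:R.
  have -> : eps^-1 ^+ m = eps ^+ 2 * eps^-1 ^+ m.+2.
    by rewrite -(addn2 m) exprD mulrCA -exprMn divff ?gt_eqF// expr1n mulr1.
  by rewrite ler_wpM2l ?sqr_ge0.
have Krho : K.+1%:R `^ rho <= 3 `^ rho * eps^-1 ^+ m.
  have -> : eps^-1 ^+ m = (eps^-1 ^+ m.+2) `^ rho.
    by rewrite -!powR_mulrn// -powRrM rhoE.
  rewrite -powRM// ?exprn_ge0//; apply: ge0_ler_powR; rewrite ?nnegrE//.
    by rewrite mulr_ge0// exprn_ge0.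
  by rewrite -natr1; move: V1 K_le; lra.
rewrite -exprVn -mulrA mulrDl mul1r lerD// -mulrA ler_wpM2l//.
by rewrite (le_trans Krho)// ler_wpM2l// powR_ge0.
Qed.

(** Since [gamma_k >= c], the [T k] are bounded by a constant, absorbed into [n] as [n >= 1]. Only
    the number of epochs brings a logarithm, hence the exponent 1. *)
Lemma complexity_le (T : nat -> nat) (L c CT rho : R) e :
  0 < L -> 0 < c -> 0 <= rho ->
  (forall k, (0 < k)%N ->
     (T k)%:R <= CT * inner_bound L (c * k%:R `^ rho)) ->
  exists C3 : R, forall (n : nat) eps, (0 < n)%N -> 0 < eps < 1 ->
  (\sum_(1 <= k < (nceil (1 / eps ^+ e)).+1) (n + T k) * up_log 2 k)%N%:R
     <= C3 * (n%:R / eps ^+ e) * (1 + ln eps^-1) ^+ 1.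
Proof.
move=> L0 c0 rho0 TCT.
set Tm := `|CT| * Num.max 2 (200 * L / c).
have Tm0 : 0 <= Tm.
  by apply: mulr_ge0; [exact: normr_ge0|rewrite le_max ler0n].
have T_le k : (0 < k)%N -> (T k)%:R <= Tm.
  move=> k0; apply: (le_trans (TCT k k0)); set b := inner_bound _ _.
  have b0 : 0 <= b by rewrite /b /inner_bound le_max ler0n.
  rewrite (le_trans (ler_wpM2r b0 (ler_norm _)))// ler_wpM2l//.
  rewrite /b /inner_bound ge_max !le_max lexx /=; apply/orP; right.
  have k1 : 1 <= k%:R `^ rho :> R.
    by rewrite -[leLHS](congr1 (fun f => f rho) (@powR1 R)) ge0_ler_powR ?nnegrE// ler1n.
  have kc : c <= c * k%:R `^ rho by rewrite ler_peMr// ltW.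
  apply: ler_wpM2l; first by apply: mulr_ge0; [exact: ler0n|exact: ltW].
  by rewrite lef_pV2 ?posrE// (lt_le_trans c0).
have ln2 : 0 < ln 2 :> R by rewrite ln_gt0// ltr1n.
(* From [2 ^ (up_log 2 K - 1) < K <= 2 eps ^ (- e)]: [up_log 2 K] is at most 2 plus [e] times the
   binary logarithm of [1 / eps]. *)
set Cu := 2 + e%:R / ln 2 : R.
exists (2 * (1 + Tm) * Cu) => n eps n0 eps01; rewrite expr1.
have [] := nceil_inv_exp e eps01; set K := nceil _ => K0 K_ge K_le.
have /andP[eps0 eps1] := eps01.
have lnV : 0 <= ln eps^-1 by rewrite ln_ge0// invf_ge1// ltW.
have n1 : 1 <= n%:R :> R by rewrite ler1n.
have up_le : (up_log 2 K)%:R <= Cu * (1 + ln eps^-1).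
  have Cu1 : 1 <= Cu by rewrite /Cu ler_wpDr ?divr_ge0 ?(ltW ln2)// ler1n.
  have [K1|K1] := leqP K 1.
    have -> : K = 1 by apply/eqP; rewrite eqn_leq K1.
    by rewrite up_log1 mulr_ge0 ?(le_trans ler01)// lerDl.
  have /andP[up_lt _] := up_log_bounds (isT : 1 < 2)%N K1.
  have : ((up_log 2 K).-1)%:R * ln 2 <= ln 2 + e%:R * ln eps^-1.
    rewrite mulr_natl -lnXn// [e%:R * _]mulr_natl -lnXn ?invr_gt0//.
    rewrite -lnM ?posrE ?exprn_gt0 ?invr_gt0// ler_ln ?posrE ?mulr_gt0 ?exprn_gt0 ?invr_gt0//.
    by rewrite (le_trans _ K_le)// -natrX ler_nat ltnW.
  have up0 : (0 < up_log 2 K)%N by rewrite up_log_gt0.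
  rewrite -ler_pdivlMr// mulrDl divff ?gt_eqF//.
  have -> : (up_log 2 K)%:R = (up_log 2 K).-1%:R + 1 :> R by rewrite natr1 prednK.
  rewrite /Cu; set l := ln eps^-1 in lnV *; set q := e%:R / ln 2.
  have -> : e%:R * l / ln 2 = q * l by rewrite mulrAC.
  have q0 : 0 <= q by rewrite divr_ge0 ?(ltW ln2).
  have : 0 <= q * l by rewrite mulr_ge0.
  lra.
have sum_le : (\sum_(1 <= k < K.+1) (n + T k) * up_log 2 k)%N%:R <=
    K%:R * (n%:R * (1 + Tm) * (Cu * (1 + ln eps^-1))).
  rewrite natr_sum -[X in X%:R * _](subn1 K.+1) mulr_natl -sumr_const_nat.
  apply: ler_sum_nat => k /andP[k0 kK]; rewrite natrM ler_pM//.
    by rewrite natrD mulrDr mulr1 lerD2l (le_trans (T_le k k0))// ler_peMl.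
  by rewrite (le_trans _ up_le)// ler_nat leq_up_log.
apply: (le_trans sum_le).
have X0 : 0 <= n%:R * (1 + Tm) * (Cu * (1 + ln eps^-1)).
  have CuL0 := le_trans (ler0n _ _) up_le.
  by rewrite mulr_ge0// mulr_ge0// addr_ge0.
apply: (le_trans (ler_wpM2r X0 K_le)).
rewrite le_eqVlt; apply/orP; left; apply/eqP; rewrite exprVn.
by move: (eps ^+ e)^-1 (ln _) => v l; ring.
Qed.

End Rates.

(** * Which draws an iterate depends on *)

Section DrawDependence.
Context {R : realType} {d n1 : nat}.
Variables (gi : 'I_n1 -> 'rV[R]_d -> R) (g h : 'rV[R]_d -> R).
Variables (mu eta : R) (p : 'rV[R]_d -> 'rV[R]_d).

Lemma eq_svrg_epoch gamma xk xbar idx idx' T :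
  (forall t, (1 <= t <= T)%N -> idx t = idx' t) ->
  svrg_epoch gi g h mu eta p gamma xk xbar idx T =
  svrg_epoch gi g h mu eta p gamma xk xbar idx' T.
Proof.
move=> idxE; rewrite /svrg_epoch; congr (_ *: _); apply: eq_big_nat => t /andP[_].
rewrite ltnS; elim: t => [//|t IH] tT /=.
by rewrite (IH (ltnW tT)) idxE.
Qed.

Lemma eq_svrg gamma xk idx idx' T S :
  (forall s t, (1 <= s <= S)%N -> (1 <= t <= T)%N -> idx s t = idx' s t) ->
  svrg gi g h mu eta p gamma xk idx T S = svrg gi g h mu eta p gamma xk idx' T S.
Proof.
elim: S => [//|S IH] idxE /=; rewrite IH => [|s t /andP[s1 sS]]; last first.
  by apply: idxE; rewrite s1 ltnW.
by apply: eq_svrg_epoch => t; apply: idxE; rewrite leqnn.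
Qed.

Lemma eq_stagewise x1 gamma T S idx idx' K k : (k <= K)%N ->
  (forall l s t, draw_position K T S (l, s, t) -> idx l s t = idx' l s t) ->
  stagewise gi g h mu eta p x1 gamma T S idx k =
  stagewise gi g h mu eta p x1 gamma T S idx' k.
Proof.
move=> + idxE; elim: k => [//|[//|k] IH] kK /=.
rewrite -/(stagewise _ _ _ _ _ _ _ _ _ _ _ k.+1) IH ?(ltnW kK)//.
by apply: eq_svrg => s t sS tT; apply: idxE; rewrite /draw_position sS tT (ltnW kK).
Qed.

End DrawDependence.

Lemma stage_weight_average_le (R : realType) (alpha : R) K (a : nat -> R) b :
  (0 < K)%N -> (forall k, (1 <= k <= K)%N -> a k <= b) ->
  \sum_(1 <= k < K.+1) stage_weight alpha K k * a k <= b.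
Proof.
move=> K0 ab; rewrite -[leRHS]mul1r -(sum_stage_weight alpha K0) mulr_suml.
by apply: ler_sum_nat => k kK; rewrite ler_wpM2l ?stage_weight_ge0// ab.
Qed.

(** * Weighted bounds along every sequence of draws *)

Section PathBounds.
Context {R : realType} {d : nat}.
Variables (g h : 'rV[R]_d -> R) (r : 'rV[R]_d -> \bar R) (x1 : 'rV[R]_d).
Variables (L c alpha Delta rho Q Q' : R) (m : nat) (T : nat -> nat).
Hypotheses (L_gt0 : 0 < L) (c_gt0 : 0 < c) (alpha_ge0 : 0 <= alpha).
Hypotheses (Delta_gt0 : 0 < Delta) (rho_ge0 : 0 <= rho) (m_gt0 : (0 < m)%N).
Hypotheses (rhoE : m.+2%:R * rho = m%:R) (Q_ge0 : 0 <= Q).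
Hypotheses (h_smooth : smooth L h) (r_proper : proper_fun r).
Hypothesis initial_gap : forall mu : R, 0 < mu < 1 -> forall x,
  (smoothed g h r mu x1 <= smoothed g h r mu x + Delta%:E)%E.
Hypothesis prox_growth : forall mu x w, 0 < mu < 1 -> prox mu r x w ->
  enorm (x - w) <= Q * (1 + enorm x).
Hypothesis prox_sublevel : forall eps p x, 0 < eps <= 1 / 2 ->
  (forall x, prox (eps ^+ m) r x (p x)) ->
  dc_objective g h r (eps ^+ m) p x <= dc_objective g h r (eps ^+ m) p x1 ->
  enorm (x - p x) <= Q' * eps.
Hypothesis T_gt0 : forall k, (0 < k)%N -> (0 < T k)%N.

Let gamma (k : nat) : R := c * k%:R `^ rho.
Let S (k : nat) := up_log 2 k.
Let gap (eps : R) p x :=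
  enorm (dc_residual g h (eps ^+ m) p x) + 2 * L * enorm (x - p x).
(** Below [eps0], [mu <= eps] gives [240 L <= 1 / mu], and the 3 ensures [eps <= 1 / 2]. *)
Let eps0 : R := (240 * L + 3)^-1.

Let gamma_ge0 k : 0 <= gamma k.
Proof. by rewrite mulr_ge0 ?powR_ge0// ltW. Qed.

Let L3 : 0 < 240 * L + 3.
Proof. by move: L_gt0; lra. Qed.

Let eps0_gt0 : 0 < eps0.
Proof. by rewrite invr_gt0. Qed.

Lemma small_eps_path_bounds : exists C1 C2 : R,
  forall n1 (gi : 'I_n1 -> 'rV[R]_d -> R) eps p idx,
  (forall i, smooth L (gi i)) -> smooth L g -> 0 < eps < 1 -> eps <= eps0 ->
  (forall x, prox (eps ^+ m) r x (p x)) ->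
  let K := nceil (1 / eps ^+ m.+2) in
  let x := stagewise gi g h (eps ^+ m) (5 / 100 / L) p x1 gamma T S idx in
  \sum_(1 <= k < K.+1) stage_weight alpha K k * enorm (x k - p (x k)) <= C1 * eps /\
  \sum_(1 <= k < K.+1) stage_weight alpha K k * gap eps p (x k) <= C2 * eps.
Proof.
(* [Ca / K] bounds every weight; [C4] collects the 1 of [U_le] and the constants of
   [stagewise_sum_residual] and [stage_modulus_le]. *)
pose Ca := 2 / (2^-1) `^ alpha : R.
pose C4 := 1 + Ca * (10 * (1 + c * 3 `^ rho) * Delta).
exists Q', (C4 + 2 * L * Q') => n1 gi eps p idx giL gL eps01 eps_small pP K x.
have [K0 _ _] := nceil_inv_exp m.+2 eps01; rewrite -/K in K0.
have /andP[eps_gt0 eps_lt1] := eps01.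
set mu := eps ^+ m in pP x *.
have mu01 : 0 < mu < 1 by exact: exprn_gt0_lt1.
have /andP[mu0 _] := mu01.
have mu_le : mu <= eps by rewrite -[leRHS]expr1 ler_wiXn2l// ltW.
have muV : 240 * L <= mu^-1.
  rewrite -[leLHS]invrK lef_pV2 ?posrE ?invr_gt0 ?mulr_gt0 ?ltr0n//.
  rewrite (le_trans mu_le)// (le_trans eps_small)// lef_pV2 ?posrE ?mulr_gt0 ?ltr0n//.
  by rewrite lerDl.
have eps_half : 0 < eps <= 1 / 2.
  rewrite eps_gt0 (le_trans eps_small)// div1r lef_pV2 ?posrE//.
  have : 0 < L by []. lra.
have gapF y : dc_objective g h r mu p x1 <= dc_objective g h r mu p y + Delta.
  by have := initial_gap mu01 y; rewrite !(smoothedE g h r_proper pP) -EFinD lee_fin.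
have gamma_ndecr k l : (k <= l)%N -> gamma k <= gamma l.
  by move=> kl; rewrite ler_pM2l// ge0_ler_powR ?nnegrE// ler_nat.
have S_gt0 k : (1 < k)%N -> (0 < S k)%N by rewrite /S up_log_gt0.
have dist_le k : enorm (x k - p (x k)) <= Q' * eps.
  apply: prox_sublevel => //.
  exact: (stagewise_objective_le x1 idx r_proper L_gt0 mu0 giL gL h_smooth pP
    gamma_ge0 T_gt0 (up_log1 2) S_gt0 muV).
split; first exact: stage_weight_average_le.
rewrite /gap; under eq_bigr do rewrite mulrDr.
rewrite big_split/= [leRHS]mulrDl lerD//; last first.
  by apply: stage_weight_average_le => // k _; rewrite -[leRHS]mulrA ler_pM2l ?mulr_gt0.
pose U k := enorm (dc_residual g h mu p (x k)).
(* Reduces the mean of [U] to a mean of squares of order [eps ^ 2]. *)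
have U_le k : U k <= eps + U k ^+ 2 / eps.
  rewrite -(ler_pM2r eps_gt0) mulrDl divfK ?gt_eqF//.
  have := sqr_ge0 (U k - eps); have := sqr_ge0 (U k + eps); nra.
have sumU : \sum_(1 <= k < K.+1) U k ^+ 2 <= 10 * (mu^-1 + gamma K.+1) * Delta.
  exact: (stagewise_sum_residual idx r_proper L_gt0 mu0 giL gL h_smooth pP
    gamma_ge0 gamma_ndecr T_gt0 (up_log1 2) S_gt0 muV gapF).
apply: (@le_trans _ _ (\sum_(1 <= k < K.+1)
    (stage_weight alpha K k * eps + Ca / K%:R / eps * U k ^+ 2))).
  apply: ler_sum_nat => k /andP[_ kK].
  apply: (le_trans (ler_wpM2l (stage_weight_ge0 _ _ _) (U_le k))).
  rewrite mulrDr lerD2l mulrA [leLHS]mulrAC ler_wpM2r ?sqr_ge0//.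
  by rewrite ler_wpM2r ?invr_ge0 ?(ltW eps_gt0)// stage_weight_le.
rewrite big_split/= -mulr_suml sum_stage_weight// -mulr_sumr mul1r mulrDl mul1r lerD2l.
have K0' : 0 < K%:R :> R by rewrite ltr0n.
have Ca0 : 0 < Ca by rewrite divr_gt0// powR_gt0// invr_gt0.
have Ceps : 0 <= Ca / K%:R / eps by rewrite !divr_ge0// ltW.
apply: (le_trans (ler_wpM2l Ceps sumU)).
have sig_le := stage_modulus_le eps01 (ltW c_gt0) rho_ge0 rhoE.
rewrite -/K -/mu in sig_le.
have sig_le' : Ca / K%:R / eps * (10 * (mu^-1 + gamma K.+1) * Delta) <=
    Ca / K%:R / eps * (10 * ((1 + c * 3 `^ rho) * eps ^+ 2 * K%:R) * Delta).
  by rewrite ler_wpM2l// ler_pM2r// ler_pM2l.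
apply: (le_trans sig_le'); rewrite le_eqVlt; apply/orP; left; apply/eqP.
by field; rewrite !gt_eqF.
Qed.

(** For [eps >= eps0] at most [K0] stages are run, so [stagewise_bounded] confines all iterates to
    one ball, and any constant [v] is at most [(v / eps0) * eps]. *)
Lemma large_eps_path_bounds : exists C1 C2 : R,
  forall n1 (gi : 'I_n1 -> 'rV[R]_d -> R) eps p idx,
  (forall i, smooth L (gi i)) -> smooth L g -> 0 < eps < 1 -> eps0 <= eps ->
  (forall x, prox (eps ^+ m) r x (p x)) ->
  let K := nceil (1 / eps ^+ m.+2) in
  let x := stagewise gi g h (eps ^+ m) (5 / 100 / L) p x1 gamma T S idx in
  \sum_(1 <= k < K.+1) stage_weight alpha K k * enorm (x k - p (x k)) <= C1 * eps /\
  \sum_(1 <= k < K.+1) stage_weight alpha K k * gap eps p (x k) <= C2 * eps.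
Proof.
pose M := eps0^-1 ^+ m.
have bounded := @stagewise_bounded _ _ g h r L Q M x1 gamma T S L_gt0 h_smooth
  gamma_ge0 Q_ge0 T_gt0 prox_growth.
have [B B_le] := choice bounded.
pose K0 := nceil (2 * eps0^-1 ^+ m.+2).
pose B' := \sum_(k < K0.+1) `|B k|.
have B'0 : 0 <= B' by rewrite sumr_ge0.
pose W := Q * (1 + B').
have W0 : 0 <= W by rewrite mulr_ge0// addr_ge0.
pose V := enorm (grad g 0) + enorm (grad h 0) + 2 * L * B' + M * W + 2 * L * W.
have M0 : 0 <= M by rewrite exprn_ge0// invr_ge0 ltW.
have V0 : 0 <= V.
  have L0 := ltW L_gt0.
  by do ![exact: enorm_ge0|exact: W0|exact: B'0|exact: M0|exact: L0|
          apply: addr_ge0|apply: mulr_ge0|exact: ler0n].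
exists (W / eps0), (V / eps0) => n1 gi eps p idx giL gL eps01 eps_large pP K x.
have [K_gt0 _ K_le] := nceil_inv_exp m.+2 eps01; rewrite -/K in K_gt0 K_le.
have /andP[eps_gt0 eps_lt1] := eps01.
have mu01 : 0 < eps ^+ m < 1 by exact: exprn_gt0_lt1.
have /andP[mu0 _] := mu01.
have epsV : eps^-1 <= eps0^-1 by rewrite lef_pV2.
have epsVX n : eps^-1 ^+ n <= eps0^-1 ^+ n.
  by apply: lerXn2r; rewrite // nnegrE invr_ge0 ltW.
have muM : (eps ^+ m)^-1 <= M by rewrite -exprVn.
have KK0 : (K <= K0)%N.
  rewrite -(ler_nat R) (le_trans K_le)//.
  apply: (@le_trans _ _ (2 * eps0^-1 ^+ m.+2)).
    by rewrite ler_pM2l.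
  have pos : 0 < 2 * eps0^-1 ^+ m.+2 by rewrite mulr_gt0// exprn_gt0// invr_gt0.
  by have /andP[] := nceil_itv pos.
have x_le k : (1 <= k <= K)%N -> enorm (x k) <= B'.
  move=> /andP[_ kK].
  apply: (le_trans (B_le k n1 gi (eps ^+ m) p idx mu01 muM giL gL pP)).
  have kK0 : (k < K0.+1)%N by rewrite ltnS (leq_trans kK).
  rewrite (le_trans (ler_norm _))// /B' (bigD1 (Ordinal kK0))//= lerDl.
  by rewrite sumr_ge0.
have dist_le k : (1 <= k <= K)%N -> enorm (x k - p (x k)) <= W.
  move=> kK; rewrite (le_trans (prox_growth mu01 (pP _)))//.
  by rewrite ler_wpM2l// lerD2l x_le.
have scale v : 0 <= v -> v <= v / eps0 * eps.
  by move=> v0; rewrite -mulrA ler_peMr// mulrC ler_pdivlMr// mul1r.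
split; apply: stage_weight_average_le => // k kK.
  by rewrite (le_trans (dist_le k kK))// scale.
apply: (le_trans _ (scale V V0)); rewrite /gap /V lerD//; last first.
  by rewrite ler_wpM2l ?dist_le// mulr_ge0// ltW.
apply: (le_trans (dc_residual_le p (x k) mu0 gL h_smooth)).
apply: lerD; first by rewrite lerD2l ler_wpM2l ?x_le// mulr_ge0// ltW.
by apply: ler_pM; rewrite ?enorm_ge0 ?invr_ge0 ?dist_le// ltW.
Qed.

End PathBounds.

(** * Distance from a point to its proximal points *)

Section ProxDistance.
Context {R : realType} {d : nat}.
Variables (g h : 'rV[R]_d -> R) (r : 'rV[R]_d -> \bar R) (x1 : 'rV[R]_d).
Variable Delta : R.
Hypothesis r_proper : proper_fun r.

(** Comparing [w] with [x] itself gives [|x - w|^2 / (2 mu) <= r x - r w <= |G| |x - w|]. *)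
Lemma prox_dist_lipschitz G mu x w :
  (forall x, r x \is a fin_num) ->
  (forall x y, `|fine (r x) - fine (r y)| <= G * enorm (x - y)) ->
  0 < mu -> prox mu r x w -> enorm (x - w) <= 2 * `|G| * mu.
Proof.
move=> rfin rG mu0 xw; have mu2 : 0 < 2 * mu by rewrite mulr_gt0.
have := prox_le r_proper xw (rfin x).
rewrite subrr enorm0 expr0n mulr0 add0r (enormB w) -lerBrDr.
set e := enorm (x - w); have e0 : 0 <= e := enorm_ge0 _.
have r_le : fine (r x) - fine (r w) <= `|G| * e.
  rewrite (le_trans (ler_norm _))// (le_trans (rG _ _))//.
  by rewrite ler_wpM2r ?ler_norm.
move=> /le_trans /(_ r_le); rewrite ler_pdivrMl// expr2.
have [->|en0] := eqVneq e 0; first by rewrite !mulr_ge0// ltW.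
have ep : 0 < e by rewrite lt_def en0.
by rewrite mulrA (ler_pM2r ep) mulrAC.
Qed.

Variables (lb : R) (y0 : 'rV[R]_d).
Hypotheses (r_ge : forall x, (lb%:E <= r x)%E) (r_y0 : r y0 \is a fin_num).

Let lb_le z : r z \is a fin_num -> lb <= fine (r z).
Proof. by move=> rz; rewrite -lee_fin fineK. Qed.

(** Comparing [w] with the fixed point [y0] gives [|x - w|^2 <= |y0 - x|^2 + 2 mu (r y0 - lb)],
    hence linear growth in [|x|]. *)
Lemma prox_dist_lower_bounded mu x w : 0 < mu < 1 -> prox mu r x w ->
  enorm (x - w) <= (enorm y0 + 2 + 2 * (fine (r y0) - lb)) * (1 + enorm x).
Proof.
move=> /andP[mu0 mu1] xw; have mu2 : 0 < 2 * mu by rewrite mulr_gt0.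
have lw := lb_le (prox_fin_num r_proper xw).
have := prox_le r_proper xw r_y0; rewrite (enormB w).
set D := fine (r y0) - lb; set e := enorm (x - w); set a := enorm (y0 - x) => e_le.
have D0 : 0 <= D by rewrite subr_ge0 lb_le.
have : (2 * mu)^-1 * (e ^+ 2 - a ^+ 2) <= D by rewrite /D; lra.
rewrite ler_pdivrMl// => e2.
have muD : 2 * mu * D <= 2 * D by rewrite ler_wpM2r// ler_piMr// ltW.
have a0 : 0 <= a := enorm_ge0 _.
have e_le' : e <= a + (1 + 2 * D).
  rewrite -(@ler_pXn2r _ 2) ?nnegrE ?enorm_ge0 ?addr_ge0 ?mulr_ge0//.
  rewrite (@le_trans _ _ (a ^+ 2 + 2 * D))//; first by lra.
  by rewrite !sqrrD; nra.
have a_le : a <= enorm y0 + enorm x by rewrite /a -[in leRHS](enormN x) enormD.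
have y0_ge0 := enorm_ge0 y0; have x_ge0 := enorm_ge0 x.
by apply: (le_trans e_le'); nra.
Qed.

Hypothesis initial_gap : forall mu : R, 0 < mu < 1 -> forall x,
  (smoothed g h r mu x1 <= smoothed g h r mu x + Delta%:E)%E.

(* The envelope at [2 mu] leaves out half of the proximal term at [mu], so the
   initial gap at [2 mu] bounds that half by the decrease of the objective. *)
Lemma prox_dist_sublevel mu p x : 0 < mu -> 2 * mu < 1 ->
  (forall x, prox mu r x (p x)) ->
  dc_objective g h r mu p x <= dc_objective g h r mu p x1 ->
  enorm (x - p x) ^+ 2 <=
  4 * mu * (g y0 - h y0 + fine (r y0) - (g x1 - h x1) - lb + 2 * Delta).
Proof.
move=> mu0 mu2 pP Fx.
have mu01 : 0 < mu < 1 by rewrite mu0; lra.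
have mu201 : 0 < 2 * mu < 1 by rewrite mu2 mulr_gt0.
have Fx1 : dc_objective g h r mu p x1 <= g y0 - h y0 + fine (r y0) + Delta.
  have := initial_gap mu01 y0; rewrite !(smoothedE g h r_proper pP) -EFinD lee_fin.
  move/le_trans; apply; rewrite lerD2r lerD2l.
  have := prox_le r_proper (pP y0) r_y0.
  by rewrite subrr enorm0 expr0n mulr0 add0r.
have rpx := prox_fin_num r_proper (pP x).
have : ((g x1 - h x1 + lb)%:E <= (g x - h x +
    ((2 * (2 * mu))^-1 * enorm (p x - x) ^+ 2 + fine (r (p x))) + Delta)%:E)%E.
  apply: (@le_trans _ _ (smoothed g h r (2 * mu) x1)).
    rewrite EFinD /smoothed; apply: leeD => //.
    apply: le_ereal_inf_tmp => _ [y _ <-]; rewrite /prox_objective.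
    rewrite -[lb%:E]add0e; apply: leeD => //.
    by rewrite lee_fin mulr_ge0 ?sqr_ge0// invr_ge0 !mulr_ge0// ltW.
  apply: (le_trans (initial_gap mu201 x)); rewrite EFinD leeD2r// EFinD /smoothed.
  apply: leeD => //; apply: ereal_inf_lbound; exists (p x) => //.
  by rewrite /prox_objective -(fineK rpx) -EFinD.
rewrite lee_fin (enormB (p x)); set e2 := enorm (x - p x) ^+ 2 => gap2.
move: Fx; rewrite {1}/dc_objective (enormB (p x)) -/e2 => Fx.
rewrite -ler_pdivrMl ?mulr_gt0//.
have -> : (4 * mu)^-1 * e2 = (2 * mu)^-1 * e2 - (2 * (2 * mu))^-1 * e2.
  by field; rewrite gt_eqF.
lra.
Qed.

End ProxDistance.

(** * The guarantee for [mu = eps ^ m], and the theorem *)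

Lemma stagewise_guarantee_of_prox_dist (R : realType) (d : nat)
    (g h : 'rV[R]_d -> R) (r : 'rV[R]_d -> \bar R) (x1 : 'rV[R]_d)
    (L c alpha Delta rho Q Q' : R) (m : nat) :
  0 < L -> 0 < c -> 1 <= alpha -> 0 < Delta -> 0 <= rho -> (0 < m)%N ->
  m.+2%:R * rho = m%:R -> 0 <= Q -> smooth L h -> proper_fun r ->
  (forall mu : R, 0 < mu < 1 -> forall x,
    (smoothed g h r mu x1 <= smoothed g h r mu x + Delta%:E)%E) ->
  (forall mu x w, 0 < mu < 1 -> prox mu r x w ->
    enorm (x - w) <= Q * (1 + enorm x)) ->
  (forall eps p x, 0 < eps <= 1 / 2 -> (forall x, prox (eps ^+ m) r x (p x)) ->
    dc_objective g h r (eps ^+ m) p x <= dc_objective g h r (eps ^+ m) p x1 ->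
    enorm (x - p x) <= Q' * eps) ->
  stagewise_guarantee g h r x1 L c alpha (fun eps => eps ^+ m) rho m.+2.
Proof.
move=> L0 c0 alpha1 Delta0 rho0 m0 rhoE Q0 hL rP gap0 growth sublevel.
pose gamma (k : nat) : R := c * k%:R `^ rho; pose S (k : nat) := up_log 2 k.
move=> T T_ge.
have alpha0 : 0 <= alpha by rewrite (le_trans ler01).
have T0 k : (0 < k)%N -> (0 < T k)%N.
  move=> k0; rewrite -(ltr0n R) (lt_le_trans _ (T_ge k k0))//.
  by rewrite /inner_bound lt_max ltr0n.
have [A1 [A2 small]] := small_eps_path_bounds L0 c0 alpha0 Delta0 rho0 m0 rhoE
  hL rP gap0 sublevel T0.
have [D1 [D2 large]] := large_eps_path_bounds g x1 alpha rho L0 c0 m0 Q0 hL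
  growth T0.
(* [C3] must be chosen before the upper bound on [T] is assumed, hence the case analysis; 0 is a
   dummy when that bound fails. *)
have [C3 complexity] : exists C3 : R,
    (exists CT : R, forall k, (0 < k)%N ->
      (T k)%:R <= CT * inner_bound L (gamma k)) ->
    forall (n : nat) eps, (0 < n)%N -> 0 < eps < 1 ->
    (\sum_(1 <= k < (nceil (1 / eps ^+ m.+2)).+1) (n + T k) * up_log 2 k)%N%:R
      <= C3 * (n%:R / eps ^+ m.+2) * (1 + ln eps^-1) ^+ 1.
  have [[CT TCT]|noCT] := pselect (exists CT : R, forall k, (0 < k)%N ->
      (T k)%:R <= CT * inner_bound L (gamma k)); last by exists 0.
  by have [C3 C3P] := complexity_le m.+2 L0 c0 rho0 TCT; exists C3.
exists 1, (Num.max A1 D1), (Num.max A2 D2), C3, 1; split=> //.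
move=> n1 n2 gi hj n1_gt0 n2_gt0 gE _ giL eps eps01 K; split; last first.
  by move=> TCT; apply: complexity => //; rewrite addn_gt0 n1_gt0.
move=> p pP disp Omega P i tau samp x.
have gL := smooth_average n1_gt0 gE giL.
have [K0 _ _] := nceil_inv_exp m.+2 eps01.
have /andP[eps_gt0 _] := eps01.
pose xs idx k := stagewise gi g h (eps ^+ m) (5 / 100 / L) p x1 gamma T S idx k.
pose dist idx k := enorm (xs idx k - p (xs idx k)).
pose gap idx k := enorm (dc_residual g h (eps ^+ m) p (xs idx k)) + 2 * L * dist idx k.
have bounds idx :
    \sum_(1 <= k < K.+1) stage_weight alpha K k * dist idx k <= Num.max A1 D1 * eps /\
    \sum_(1 <= k < K.+1) stage_weight alpha K k * gap idx k <= Num.max A2 D2 * eps.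
  have [le|/ltW ge] := leP eps (240 * L + 3)^-1.
    have [] := small n1 gi eps p idx giL gL eps01 le pP.
    by split; [move: a|move: b]; move/le_trans; apply; rewrite ler_pM2r// le_max lexx.
  have [] := large n1 gi eps p idx giL gL eps01 ge pP.
  by split; [move: a|move: b]; move/le_trans; apply; rewrite ler_pM2r// le_max lexx orbT.
have dist0 k idx : 0 <= dist idx k by exact: enorm_ge0.
have gap_ge0 k idx : 0 <= gap idx k.
  by rewrite addr_ge0 ?enorm_ge0// !mulr_ge0// ltW.
have xsE k idx idx' : (1 <= k <= K)%N ->
    (forall l s t, draw_position K T S (l, s, t) -> idx l s t = idx' l s t) ->
    xs idx k = xs idx' k.
  by move=> /andP[_ kK]; exact: eq_stagewise.
split.
  rewrite unlock.
  apply: (sampling_integral_le (Psi := fun k idx => dist idx k) n1_gt0 K0 samp) => //.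
  - by move=> w; rewrite lee_fin enorm_ge0.
  - by move=> k idx idx' kK E; rewrite /dist (xsE k idx idx').
  - by move=> idx; have [] := bounds idx.
apply: (sampling_integral_le (Psi := fun k idx => gap idx k) n1_gt0 K0 samp) => //.
- move=> w; apply: le_ereal_inf_tmp => _ [a _ [b _ <-]].
  by rewrite lee_fin enorm_ge0.
- move=> w _; have /andP[mu0 _] := exprn_gt0_lt1 m0 eps01.
  exact: stationarity_gap_le.
- by move=> k idx idx' kK E; rewrite /gap /dist (xsE k idx idx').
- by move=> idx; have [] := bounds idx.
Qed.

Theorem theorem13 (R : realType) (d : nat)
    (g h : 'rV[R]_d -> R) (r : 'rV[R]_d -> \bar R) (x1 : 'rV[R]_d)
    (L c alpha Delta : R)
    (L_gt0 : 0 < L) (c_gt0 : 0 < c) (alpha_ge1 : 1 <= alpha)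
    (Delta_gt0 : 0 < Delta)
    (g_convex : convex_fun g) (g_lsc : lower_semicontinuous (EFin \o g))
    (h_convex : convex_fun h) (h_lsc : lower_semicontinuous (EFin \o h))
    (h_smooth : smooth L h)
    (r_proper : proper_fun r) (r_lsc : lower_semicontinuous r)
    (initial_gap : forall mu : R, 0 < mu < 1 -> forall x,
      (smoothed g h r mu x1 <= smoothed g h r mu x + Delta%:E)%E) :
  (cond_R1 r ->
     stagewise_guarantee g h r x1 L c alpha (fun eps => eps) (1 / 3) 3) /\
  (cond_R2 r \/ cond_R3 g h r ->
     stagewise_guarantee g h r x1 L c alpha (fun eps => eps ^+ 2) (1 / 2) 4).
Proof.
split=> [[rfin [G rG]]|].
  have dist_le mu x w : 0 < mu -> prox mu r x w -> enorm (x - w) <= 2 * `|G| * mu.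
    exact: prox_dist_lipschitz.
  (* Case (a) is [m = 1], [rho = 1 / 3]; case (b) is [m = 2], [rho = 1 / 2]. *)
  have -> : (fun eps : R => eps) = (fun eps => eps ^+ 1) by apply/funext => eps; rewrite expr1.
  apply: (@stagewise_guarantee_of_prox_dist _ _ _ _ _ _ _ _ _ Delta _
    (2 * `|G|) (2 * `|G|)) => //.
  - lra.
  - move=> mu x w /andP[mu0 mu1] xw; rewrite (le_trans (dist_le mu x w mu0 xw))//.
    by rewrite ler_wpM2l ?mulr_ge0// (le_trans (ltW mu1))// lerDl enorm_ge0.
  - by move=> eps p x /andP[eps0 _] pP _; exact: dist_le.
move=> R23; have [lb r_ge] : lower_bounded r by case: R23 => [[]|[]].
have [rNy [y0 y0y]] := r_proper.
have r_y0 : r y0 \is a fin_num by rewrite fin_numE rNy lt_eqF.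
have D0 : 0 <= fine (r y0) - lb by rewrite subr_ge0 -lee_fin fineK.
set C0 := g y0 - h y0 + fine (r y0) - (g x1 - h x1) - lb + 2 * Delta.
apply: (@stagewise_guarantee_of_prox_dist _ _ _ _ _ _ _ _ _ Delta _
  (enorm y0 + 2 + 2 * (fine (r y0) - lb)) (2 * (1 + `|C0|))) => //.
- lra.
- by rewrite !addr_ge0 ?enorm_ge0 ?mulr_ge0.
- by move=> mu x w; exact: prox_dist_lower_bounded.
- move=> eps p x /andP[eps0 eps_half] pP Fx.
  have mu0 : 0 < eps ^+ 2 by rewrite exprn_gt0.
  (* [eps <= 1 / 2] makes the initial gap available at [2 mu] too. *)
  have mu2 : 2 * eps ^+ 2 < 1 by nra.
  have := prox_dist_sublevel r_proper r_ge r_y0 initial_gap mu0 mu2 pP Fx.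
  rewrite -/C0 => e2; rewrite -(@ler_pXn2r _ 2) ?nnegrE ?enorm_ge0//; last first.
    by rewrite !mulr_ge0 ?addr_ge0// ltW.
  apply: (le_trans e2).
  (* [C0] is replaced by a perfect square, so that the bound on the squared distance has an explicit
     root. *)
  have C0_le : C0 <= (1 + `|C0|) ^+ 2.
    by have := ler_norm C0; have := normr_ge0 C0; nra.
  have -> : (2 * (1 + `|C0|) * eps) ^+ 2 = 4 * eps ^+ 2 * (1 + `|C0|) ^+ 2 by ring.
  by rewrite ler_pM2l// mulr_gt0.
Qed.
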